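(* Let $A$ be an algebraic quantum groupoid with canonical idempotent $E=E_{(1)}\otimes E_{(2)}$, antipode $S$ and dual $\hat A$. The algebra $A\#_{\hat E}\hat A$, acting on $A$ by $(a\#_{\hat E}b)a'=\sum aa'_{(1)}\langle a'_{(2)},b\rangle$ for $a,a'\in A$, $b\in\hat A$, is the span of the maps from $A$ to $A$ of the form $$a'\mapsto aS(E_{(1)})\,\varphi(E_{(2)}c\,a'),$$ where $a,c\in A$ and $\varphi$ is a left integral on $A$.
   Context: Conventions. Algebras are associative over $\mathbb{C}$, possibly without unit, with non-degenerate product ($ab=0$ for all $b$ implies $a=0$; $ba=0$ for all $b$ implies $a=0$). $M(A)$ is the multiplier algebra of $A$ (pairs $(l,r)$ of linear maps $A\to A$ with $l(ab)=l(a)b$, $r(ab)=ar(b)$, $r(a)b=al(b)$), $1$ its identity, and $\iota$ denotes identity maps. A coproduct on $A$ is a homomorphism $\Delta:A\to M(A\otimes A)$ with $\Delta(a)(1\otimes b),(a\otimes 1)\Delta(b)\in A\otimes A$ and $(c\otimes 1\otimes 1)(\Delta\otimes\iota)(\Delta(a)(1\otimes b))=(\iota\otimes\Delta)((c\otimes 1)\Delta(a))(1\otimes 1\otimes b)$. It is full if the smallest subspaces $V,W\subseteq A$ with $\Delta(A)(1\otimes A)\subseteq V\otimes A$ and $(A\otimes 1)\Delta(A)\subseteq A\otimes W$ are both $A$; it is regular if also $\Delta(a)(b\otimes 1),(1\otimes a)\Delta(b)\in A\otimes A$. Put $T_1(a\otimes b)=\Delta(a)(1\otimes b)$, $T_2(a\otimes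 b)=(a\otimes 1)\Delta(b)$. A counit is a linear $\varepsilon:A\to\mathbb{C}$ with $(\varepsilon\otimes\iota)(\Delta(a)(1\otimes b))=ab=(\iota\otimes\varepsilon)((a\otimes 1)\Delta(b))$. A weak multiplier Hopf algebra is $(A,\Delta)$ with $A$ non-degenerate, $A^2=A$, $\Delta$ a full coproduct with a counit, such that (i) there is an idempotent $E\in M(A\otimes A)$ (the canonical idempotent) with $T_1(A\otimes A)=E(A\otimes A)$, $T_2(A\otimes A)=(A\otimes A)E$; (ii) $(\iota\otimes\Delta)E=(E\otimes 1)(1\otimes E)=(1\otimes E)(E\otimes 1)$, where $\Delta$ and $\iota\otimes\Delta$ are extended to multipliers with $\Delta(1)=E$; (iii) $\ker T_i=(1-G_i)(A\otimes A)$ for $i=1,2$, where $G_1,G_2$ are the linear maps on $A\otimes A$ with $(G_1\otimes\iota)(\Delta_{13}(a)(1\otimes b\otimes c))=\Delta_{13}(a)(1\otimes E)(1\otimes b\otimes c)$ and $(\iota\otimes G_2)((a\otimes b\otimes 1)\Delta_{13}(c))=(a\otimes b\otimes 1)(E\otimes 1)\Delta_{13}(c)$ ($\Delta_{13}$ is $\Delta$ placed in the first and third legs). It is regular if $\Delta$ is regular and $(A,\Delta^{cop})$ ($\Delta$ followed by the flip) is also a weak multiplier Hopf algebra. Sweedler notation $\Delta(a)=\sum a_{(1)}\otimes a_{(2)}$ is used when covered by suitable factors; $E=E_{(1)}\otimes E_{(2)}$. The antipode $S:A\to M(A)$ is the anti-homomorphism such that $R_1(a\otimes b)=\sum a_{(1)}\otimes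 S(a_{(2)})b$ and $R_2(a\otimes b)=\sum aS(b_{(1)})\otimes b_{(2)}$ are maps on $A\otimes A$ with $T_1R_1=E\,\cdot$, $R_1T_1=G_1$, $T_2R_2=\cdot\,E$, $R_2T_2=G_2$; if $A$ is regular, $S$ is a bijection $A\to A$, and it is extended to $M(A)$ (so $aS(E_{(1)})\otimes E_{(2)}c=S(E_{(1)}S^{-1}(a))\otimes E_{(2)}c\in A\otimes A$). Integrals and duality. Let $A$ be regular and $A_t=\{x\in M(A): (c\otimes 1)\Delta(xa)=(cx\otimes 1)\Delta(a)\ \forall a,c\in A\}$. A left integral is a non-zero linear functional $\varphi$ on $A$ with $(\iota\otimes\varphi)\Delta(a)\in A_t$ for all $a$. $A$ is an algebraic quantum groupoid if it has a faithful set of left integrals: $x=0$ whenever $\varphi(xa)=0$ for all left integrals $\varphi$ and all $a\in A$, and $x=0$ whenever $\varphi(ax)=0$ for all such $\varphi,a$. Its dual $\hat A$ is the span of the functionals $\varphi(a\,\cdot\,)$ ($\varphi$ a left integral, $a\in A$); write $\langle a,f\rangle=f(a)$. $\hat A$ is a regular weak multiplier Hopf algebra with product $(\omega\omega')(x)=(\omega\otimes\omega')\Delta(x)$ and coproduct $\hat\Delta$ given by $\langle x\otimes y,\hat\Delta(\omega)(1\otimes\omega')\rangle=\langle (x\otimes 1)\Delta(y),\omega\otimes\omega'\rangle$, $\langle x\otimes y,(\omega\otimes 1)\hat\Delta(\omega')\rangle=\langle\Delta(x)(1\otimes y),\omega\otimes\omega'\rangle$; its canonical idempotent $\hat E$ satisfies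 $\langle x\otimes y,\hat E\rangle=\varepsilon(xy)$. Smash product. $A$ is a unital left $\hat A$-module algebra by $b\rhd a=\sum a_{(1)}\langle a_{(2)},b\rangle$. $A\#\hat A$ is $A\otimes\hat A$ with product $(a\# b)(a'\# b')=\sum a(b_{(1)}\rhd a')\# b_{(2)}b'$. The algebra $M(\hat A\otimes\hat A)$ acts on $A\otimes\hat A$ (extending the action of $\hat A\otimes\hat A$ by $\rhd$ on the first leg and left multiplication on the second), and $A\#_{\hat E}\hat A:=\hat E\rhd(A\#\hat A)$, a subalgebra with elements $a\#_{\hat E}b:=\hat E\rhd(a\# b)$. The stated action on $A$ makes $A$ a faithful left $A\#_{\hat E}\hat A$-module. *)

(* Defs.v *)
From HB Require Import structures.
From mathcomp Require Import all_boot all_order all_algebra generic_quotient.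
From mathcomp Require Import sesquilinear.
From mathcomp Require Import boolp classical_sets functions reals.
From mathcomp Require Import complex.

Set Implicit Arguments.
Unset Strict Implicit.
Unset Printing Implicit Defensive.

Import GRing.Theory.
Local Open Scope ring_scope.
Local Open Scope quotient_scope.
Local Open Scope classical_set_scope.

Declare Scope walg_scope.
Delimit Scope walg_scope with walg.
Local Open Scope walg_scope.

Notation is_bilinear f := (bilinear_for *:%R *:%R f).

Section LinearSpan.
Variables (K : fieldType) (V : lmodType K).

Definition lspan (X : set V) : set V :=
  [set v | exists s : seq (K * V),
     (forall p, p \in s -> X p.2) /\ v = \sum_(p <- s) p.1 *: p.2].

Definition is_subspace (X : set V) : Prop :=
  X 0 /\ forall (k : K) (u v : V), X u -> X v -> X (k *: u + v).

End LinearSpan.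

(* The tensor product of two K-vector spaces: finite formal sums of pairs,
   two of them being identified when no bilinear map separates them. *)
Section TensorProduct.
Variables (K : fieldType) (V W : lmodType K).

Definition formal_eval (U : lmodType K) (f : V -> W -> U)
  (s : seq (V * W)) : U := \sum_(p <- s) f p.1 p.2.

Definition tens_rel (s t : seq (V * W)) : bool :=
  `[< forall (U : lmodType K) (f : V -> W -> U),
        is_bilinear f -> formal_eval f s = formal_eval f t >].

Lemma tens_rel_refl : reflexive tens_rel.
Proof. by move=> s; apply/asboolP. Qed.

Lemma tens_rel_sym : symmetric tens_rel.
Proof.
by move=> s t; apply/asboolP/asboolP => H U f hf; rewrite (H U f hf).
Qed.

Lemma tens_rel_trans : transitive tens_rel.
Proof.
move=> t s u /asboolP st /asboolP tu; apply/asboolP => U f hf.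
by rewrite st// tu.
Qed.

Canonical tens_equiv : equiv_rel (seq (V * W)) :=
  EquivRel tens_rel tens_rel_refl tens_rel_sym tens_rel_trans.

Definition tens : Type := {eq_quot tens_rel}.
HB.instance Definition _ : EqQuotient _ tens_rel tens := EqQuotient.on tens.
HB.instance Definition _ := Choice.on tens.

(* The linear map induced by f; it is meaningful when f is bilinear. *)
Definition tlift (U : lmodType K) (f : V -> W -> U) (t : tens) : U :=
  formal_eval f (repr t).

Lemma tens_eqP (s t : seq (V * W)) :
  \pi_tens s = \pi_tens t <->
  forall (U : lmodType K) (f : V -> W -> U),
    is_bilinear f -> formal_eval f s = formal_eval f t.
Proof. by split => [/eqmodP/asboolP|H]; last exact/eqmodP/asboolP. Qed.

Lemma tlift_pi (U : lmodType K) (f : V -> W -> U) s :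
  is_bilinear f -> tlift f (\pi_tens s) = formal_eval f s.
Proof.
move=> hf; rewrite /tlift; apply: (proj1 (tens_eqP _ _)) => //.
by rewrite reprK.
Qed.

Lemma tens_ext (x y : tens) :
  (forall (U : lmodType K) (f : V -> W -> U),
     is_bilinear f -> tlift f x = tlift f y) -> x = y.
Proof.
by move=> H; rewrite -[x]reprK -[y]reprK; apply/tens_eqP => U f /H.
Qed.

Definition tens0 : tens := \pi_tens [::].
Definition tens_add (x y : tens) : tens := \pi_tens (repr x ++ repr y).
Definition tens_scale (k : K) (x : tens) : tens :=
  \pi_tens [seq (k *: p.1, p.2) | p <- repr x].
Definition tens_opp (x : tens) : tens := tens_scale (- 1) x.

Section Eval.
Variables (U : lmodType K) (f : V -> W -> U) (hf : is_bilinear f).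

Lemma tlift_tens0 : tlift f tens0 = 0.
Proof. by rewrite tlift_pi// /formal_eval big_nil. Qed.

Lemma tlift_tens_add x y : tlift f (tens_add x y) = tlift f x + tlift f y.
Proof. by rewrite tlift_pi// /formal_eval big_cat. Qed.

Lemma tlift_tens_scale k x : tlift f (tens_scale k x) = k *: tlift f x.
Proof.
rewrite tlift_pi// /formal_eval big_map /= scaler_sumr.
by apply: eq_bigr => p _; have /scalable_linear -> := hf.1 p.2.
Qed.

End Eval.

Let tensE := (tlift_tens0, tlift_tens_add, tlift_tens_scale).

Lemma tens_addA : associative tens_add.
Proof. by move=> x y z; apply: tens_ext => U f hf; rewrite !tensE// addrA. Qed.
Lemma tens_addC : commutative tens_add.
Proof. by move=> x y; apply: tens_ext => U f hf; rewrite !tensE// addrC. Qed.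
Lemma tens_add0 : left_id tens0 tens_add.
Proof. by move=> x; apply: tens_ext => U f hf; rewrite !tensE// add0r. Qed.
Lemma tens_addN : left_inverse tens0 tens_opp tens_add.
Proof.
by move=> x; apply: tens_ext => U f hf; rewrite !tensE// scaleN1r addNr.
Qed.

HB.instance Definition _ :=
  GRing.isZmodule.Build tens tens_addA tens_addC tens_add0 tens_addN.

Lemma tens_scaleA a b x :
  tens_scale a (tens_scale b x) = tens_scale (a * b) x.
Proof. by apply: tens_ext => U f hf; rewrite !tensE// scalerA. Qed.
Lemma tens_scale1 : left_id 1 tens_scale.
Proof. by move=> x; apply: tens_ext => U f hf; rewrite !tensE// scale1r. Qed.
Lemma tens_scaleDr : right_distributive tens_scale +%R.
Proof. by move=> a x y; apply: tens_ext => U f hf; rewrite !tensE// scalerDr. Qed.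
Lemma tens_scaleDl x : {morph tens_scale^~ x : a b / a + b}.
Proof. by move=> a b; apply: tens_ext => U f hf; rewrite !tensE// scalerDl. Qed.

HB.instance Definition _ := GRing.Zmodule_isLmodule.Build K tens
  tens_scaleA tens_scale1 tens_scaleDr tens_scaleDl.

Definition tpure (v : V) (w : W) : tens := \pi_tens [:: (v, w)].

Lemma tlift_linear (U : lmodType K) (f : V -> W -> U) :
  is_bilinear f -> linear (tlift f).
Proof.
move=> hf k x y; rewrite -[k *: x + y]/(tens_add (tens_scale k x) y).
by rewrite !tensE.
Qed.

Lemma tlift_pure (U : lmodType K) (f : V -> W -> U) v w :
  is_bilinear f -> tlift f (tpure v w) = f v w.
Proof. by move=> hf; rewrite tlift_pi// /formal_eval big_seq1. Qed.

Lemma tpure_bilinear : is_bilinear tpure.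
Proof.
split=> [w k v v'|v k w w']; apply: tens_ext => U f hf;
  rewrite tlift_linear// !tlift_pure//.
  exact: hf.1.
exact: hf.2.
Qed.

Lemma tens_pureE (t : tens) : t = \sum_(p <- repr t) tpure p.1 p.2.
Proof.
apply: tens_ext => U f hf.
have h0 : tlift f 0 = 0 by exact: tlift_tens0.
have hD : {morph tlift f : x y / x + y} by exact: tlift_tens_add.
rewrite (big_morph _ hD h0) /tlift /formal_eval.
by apply: eq_bigr => p _; rewrite -tlift_pure.
Qed.

Lemma tens_lin_ext (U : lmodType K) (f g : tens -> U) :
  linear f -> linear g ->
  (forall v w, f (tpure v w) = g (tpure v w)) -> f =1 g.
Proof.
move=> lf lg fg t; rewrite (tens_pureE t).
have aux (h : tens -> U) : linear h -> {morph h : x y / x + y} /\ h 0 = 0.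
  move=> lh; have hD : {morph h : x y / x + y}.
    by move=> x y; rewrite -[x]scale1r lh !scale1r.
  by split=> //; apply: (addrI (h 0)); rewrite -hD !addr0.
have [fD f0] := aux _ lf; have [gD g0] := aux _ lg.
by rewrite (big_morph _ fD f0) (big_morph _ gD g0); apply: eq_bigr.
Qed.

End TensorProduct.

Arguments tens {K} (V W)%_type_scope.
Notation "V ⊗ W" := (tens V W) (at level 40, left associativity) : type_scope.
Notation "v ⊗ w" := (tpure v w) (at level 40, left associativity) : walg_scope.

(* Associative, possibly non-unital algebras over K. *)
Record algebra (K : fieldType) := Algebra {
  carrier :> lmodType K;
  amul : carrier -> carrier -> carrier;
  amulA : associative amul;
  amul_bilinear : is_bilinear amul
}.

Notation "a ∙ b" := (amul a b) (at level 40, left associativity) : walg_scope.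

Section BilinearTools.
Variables (K : fieldType).

Lemma bilin_comp (V W V' W' U : lmodType K) (h : V' -> W' -> U)
  (f : V -> V') (g : W -> W') :
  is_bilinear h -> linear f -> linear g ->
  is_bilinear (fun v w => h (f v) (g w)).
Proof.
move=> hh hf hg; split=> [w k v v'|v k w w'] /=.
  by rewrite hf; apply: hh.1.
by rewrite hg; apply: hh.2.
Qed.

Lemma bilin_post (V W U U' : lmodType K) (h : V -> W -> U) (f : U -> U') :
  is_bilinear h -> linear f -> is_bilinear (fun v w => f (h v w)).
Proof.
move=> hh hf; split=> [w k v v'|v k w w'] /=.
  by rewrite (hh.1 w) hf.
by rewrite (hh.2 v) hf.
Qed.

Lemma linear_id (V : lmodType K) : linear (@id V).
Proof. by []. Qed.

Lemma linear_comp (U V W : lmodType K) (f : V -> W) (g : U -> V) :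
  linear f -> linear g -> linear (fun x => f (g x)).
Proof. by move=> hf hg k x y; rewrite hg hf. Qed.

Lemma linear_sumf (V W : lmodType K) (f g : V -> W) (k : K) :
  linear f -> linear g -> linear (fun x => k *: f x + g x).
Proof.
move=> hf hg c x y; rewrite hf hg !scalerDr !scalerA (mulrC k c) -!addrA.
by congr (_ + _); rewrite addrCA.
Qed.

Lemma tlift_bilinear (V W V' W' U : lmodType K) (F : V -> W -> V' -> W' -> U) :
  (forall v w, is_bilinear (F v w)) ->
  (forall v' w', is_bilinear (fun v w => F v w v' w')) ->
  forall t, is_bilinear (fun v w => tlift (F v w) t).
Proof.
move=> h1 h2 t; rewrite /tlift /formal_eval.
elim: (repr t) => [|p s [IH1 IH2]].
  by split=> ? ? ? ? /=; rewrite !big_nil scaler0 addr0.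
split=> [w k v v'|v k w w'] /=; rewrite !big_cons.
  by rewrite (IH1 w k v v') ((h2 p.1 p.2).1 w k v v') scalerDr addrACA.
by rewrite (IH2 v k w w') ((h2 p.1 p.2).2 v k w w') scalerDr addrACA.
Qed.

Lemma tlift_param (X V W U : lmodType K) (F : X -> V -> W -> U) t :
  (forall v w, linear (fun x => F x v w)) -> linear (fun x => tlift (F x) t).
Proof.
move=> hF k x y; rewrite /tlift /formal_eval scaler_sumr -big_split /=.
by apply: eq_bigr => p _; rewrite hF.
Qed.

End BilinearTools.

Section TensorMap.
Variables (K : fieldType) (V W V' W' : lmodType K).

Definition tmap (f : V -> V') (g : W -> W') (t : V ⊗ W) : V' ⊗ W' :=
  tlift (fun v w => f v ⊗ g w) t.

Lemma tmap_linear f g : linear f -> linear g -> linear (tmap f g).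
Proof.
move=> hf hg; apply: tlift_linear.
exact: bilin_comp (@tpure_bilinear _ _ _) hf hg.
Qed.

Lemma tmap_pure f g v w : linear f -> linear g ->
  tmap f g (v ⊗ w) = f v ⊗ g w.
Proof.
move=> hf hg; rewrite /tmap tlift_pure//.
exact: bilin_comp (@tpure_bilinear _ _ _) hf hg.
Qed.

End TensorMap.

Section TensorAlgebra.
Variables (K : fieldType) (A B : algebra K).

Definition tmul (s t : A ⊗ B) : A ⊗ B :=
  tlift (fun a b => tlift (fun a' b' => (a ∙ a') ⊗ (b ∙ b')) t) s.

Lemma tmul_bil_in a b :
  is_bilinear (fun (a' : A) (b' : B) => (a ∙ a') ⊗ (b ∙ b')).
Proof.
apply: bilin_comp (@tpure_bilinear _ _ _) _ _; exact: (amul_bilinear _).2.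
Qed.

Lemma tmul_bil_out a' b' :
  is_bilinear (fun (a : A) (b : B) => (a ∙ a') ⊗ (b ∙ b')).
Proof.
apply: (@bilin_comp _ A B _ _ _ (@tpure K A B) (fun a => a ∙ a')
  (fun b => b ∙ b') (@tpure_bilinear _ _ _)); exact: (amul_bilinear _).1.
Qed.

Lemma tmul_bil_mid t :
  is_bilinear
    (fun (a : A) (b : B) => tlift (fun a' b' => (a ∙ a') ⊗ (b ∙ b')) t).
Proof.
exact: (tlift_bilinear (F := fun a b a' b' => (a ∙ a') ⊗ (b ∙ b'))
          tmul_bil_in tmul_bil_out).
Qed.

Lemma tmul_bilinear : is_bilinear tmul.
Proof.
split=> [t|s]; first exact: tlift_linear (tmul_bil_mid t).
apply: (tlift_param (F := fun t a b =>
  tlift (fun a' b' => (a ∙ a') ⊗ (b ∙ b')) t)) => a b.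
exact: tlift_linear (tmul_bil_in a b).
Qed.

Lemma tmul_pure a b a' b' :
  tmul (a ⊗ b) (a' ⊗ b') = (a ∙ a') ⊗ (b ∙ b').
Proof.
rewrite /tmul tlift_pure; last exact: tmul_bil_mid.
by rewrite tlift_pure//; exact: tmul_bil_in.
Qed.

Lemma tmulA : associative tmul.
Proof.
have [bl br] := tmul_bilinear.
move=> x y z.
apply: (tens_lin_ext (f := fun x => tmul x (tmul y z))
                     (g := fun x => tmul (tmul x y) z)) => [||a b].
- exact: bl.
- by apply: linear_comp (bl z) (bl y).
apply: (tens_lin_ext (f := fun y => tmul (a ⊗ b) (tmul y z))
                     (g := fun y => tmul (tmul (a ⊗ b) y) z)) => [||a' b'].
- by apply: linear_comp (br _) (bl _).
- by apply: linear_comp (bl _) (br _).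
apply: (tens_lin_ext (f := fun z => tmul (a ⊗ b) (tmul (a' ⊗ b') z))
          (g := fun z => tmul (tmul (a ⊗ b) (a' ⊗ b')) z)) => [||a'' b''].
- by apply: linear_comp (br _) (br _).
- exact: br.
by rewrite !tmul_pure !amulA.
Qed.

Definition tens_alg : algebra K := Algebra tmulA tmul_bilinear.

End TensorAlgebra.

Notation "A ⊠ B" := (tens_alg A B) (at level 40, left associativity)
  : walg_scope.

Section Multipliers.
Variables (K : fieldType) (A : algebra K).

Definition is_multiplier (m : (A -> A) * (A -> A)) : Prop :=
  [/\ linear m.1, linear m.2,
      forall a b, m.1 (a ∙ b) = m.1 a ∙ b,
      forall a b, m.2 (a ∙ b) = a ∙ m.2 b
    & forall a b, m.2 a ∙ b = a ∙ m.1 b].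

Definition multiplier_pred : {pred (A -> A) * (A -> A)} :=
  fun m => `[< is_multiplier m >].

Record multiplier := Multiplier {
  mult_pair : (A -> A) * (A -> A);
  mult_pairP : mult_pair \in multiplier_pred
}.

HB.instance Definition _ := [isSub for mult_pair].
HB.instance Definition _ := [Choice of multiplier by <:].

Lemma multiplier_submod : submod_closed multiplier_pred.
Proof.
have [bl br] := amul_bilinear A.
have a0 (a : A) : a ∙ 0 = 0.
  by apply: (addrI (a ∙ 0)); rewrite -[X in X + _]scale1r -br scaler0 !addr0.
have a0' (a : A) : 0 ∙ a = 0.
  by apply: (addrI (0 ∙ a)); rewrite -[X in X + _]scale1r -bl scaler0 !addr0.
split=> [|k m n /asboolP[ml mr mll mrr mm] /asboolP[nl nr nll nrr nn]].
  apply/asboolP; split=> [c x y|c x y|a b|a b|a b] /=;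
    by rewrite ?a0 ?a0' ?scaler0 ?addr0.
apply/asboolP; split=> [||a b|a b|a b] /=.
- by move=> c x y; exact: (linear_sumf k ml nl c x y).
- by move=> c x y; exact: (linear_sumf k mr nr c x y).
- by rewrite [LHS]/(k *: m.1 _ + n.1 _) mll nll; exact: esym (bl b k _ _).
- by rewrite [LHS]/(k *: m.2 _ + n.2 _) mrr nrr; exact: esym (br a k _ _).
- transitivity (k *: (m.2 a ∙ b) + n.2 a ∙ b); first exact: (bl b).
  by rewrite mm nn; exact: esym (br a k _ _).
Qed.

HB.instance Definition _ :=
  GRing.SubChoice_isSubLmodule.Build K _ multiplier_pred multiplier
    multiplier_submod.

(* lact m a = m a and ract m a = a m *)
Definition lact (m : multiplier) : A -> A := (mult_pair m).1.
Definition ract (m : multiplier) : A -> A := (mult_pair m).2.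

Lemma multiplierP (m : multiplier) : is_multiplier (lact m, ract m).
Proof. by case: m => [[l r] lrP]; move/asboolP: (lrP). Qed.

Definition mkmult (l r : A -> A) (H : is_multiplier (l, r)) : multiplier :=
  @Multiplier (l, r) (introT (asboolP _) H).

Lemma multiplier_ext (m n : multiplier) :
  lact m =1 lact n -> ract m =1 ract n -> m = n.
Proof.
move=> hl hr; apply: val_inj.
case: m n hl hr => [[l r] hm] [[l' r'] hn] /= hl hr.
by congr pair; apply/funext.
Qed.

Lemma mult1_subproof : is_multiplier (id, id).
Proof. by split. Qed.
Definition mult1 : multiplier := mkmult mult1_subproof.

Lemma mmul_subproof (m n : multiplier) :
  is_multiplier (fun a => lact m (lact n a), fun a => ract n (ract m a)).
Proof.
have [/= ml mr mll mrr mm] := multiplierP m.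
have [/= nl nr nll nrr nn] := multiplierP n.
split=> [||a b|a b|a b] /=.
- exact: linear_comp ml nl.
- exact: linear_comp nr mr.
- by rewrite nll mll.
- by rewrite mrr nrr.
- by rewrite nn mm.
Qed.
Definition mmul (m n : multiplier) : multiplier := mkmult (mmul_subproof m n).

Lemma memb_subproof (a : A) : is_multiplier (fun b => a ∙ b, fun b => b ∙ a).
Proof.
have [bl br] := amul_bilinear A.
by split=> [||b c|b c|b c] /=; [exact: br|exact: bl|rewrite amulA..].
Qed.
Definition memb (a : A) : multiplier := mkmult (memb_subproof a).

Definition in_algebra (m : multiplier) : Prop := exists a : A, memb a = m.

(* The element a of A such that memb a = m, when there is one; it is unique as
   soon as the product of A is non-degenerate. *)
Definition munemb (m : multiplier) : A := xget 0 [set a | memb a = m].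

Definition nondegenerate : Prop :=
  (forall a : A, (forall b, a ∙ b = 0) -> a = 0) /\
  (forall a : A, (forall b, b ∙ a = 0) -> a = 0).

Definition idempotent_algebra : Prop :=
  lspan [set x : A | exists a b, x = a ∙ b] = setT.

End Multipliers.

Notation "m · n" := (mmul m n) (at level 40, left associativity) : walg_scope.
Notation "𝟙" := (mult1 _) : walg_scope.

Section TensorMultiplier.
Variables (K : fieldType) (A B : algebra K).

Lemma mtens_subproof (m : multiplier A) (n : multiplier B) :
  is_multiplier (A := A ⊠ B)
    (tmap (lact m) (lact n), tmap (ract m) (ract n)).
Proof.
have [/= ml mr mll mrr mm] := multiplierP m.
have [/= nl nr nll nrr nn] := multiplierP n.
have [bl br] := @tmul_bilinear _ A B.
have hl := tmap_linear ml nl; have hr := tmap_linear mr nr.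
split=> // x y /=.
- apply: (tens_lin_ext (f := fun x => tmap (lact m) (lact n) (tmul x y))
    (g := fun x => tmul (tmap (lact m) (lact n) x) y)) => [||a b].
  + exact: linear_comp hl (bl _).
  + exact: linear_comp (bl _) hl.
  apply: (tens_lin_ext (f := fun y => tmap (lact m) (lact n) (tmul (a ⊗ b) y))
    (g := fun y => tmul (tmap (lact m) (lact n) (a ⊗ b)) y)) => [||a' b'].
  + exact: linear_comp hl (br _).
  + exact: br.
  by rewrite tmul_pure !tmap_pure// tmul_pure mll nll.
- apply: (tens_lin_ext (f := fun x => tmap (ract m) (ract n) (tmul x y))
    (g := fun x => tmul x (tmap (ract m) (ract n) y))) => [||a b].
  + exact: linear_comp hr (bl _).
  + exact: bl.
  apply: (tens_lin_ext (f := fun y => tmap (ract m) (ract n) (tmul (a ⊗ b) y))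
    (g := fun y => tmul (a ⊗ b) (tmap (ract m) (ract n) y))) => [||a' b'].
  + exact: linear_comp hr (br _).
  + exact: linear_comp (br _) hr.
  by rewrite tmul_pure !tmap_pure// tmul_pure mrr nrr.
- apply: (tens_lin_ext (f := fun x => tmul (tmap (ract m) (ract n) x) y)
    (g := fun x => tmul x (tmap (lact m) (lact n) y))) => [||a b].
  + exact: linear_comp (bl _) hr.
  + exact: bl.
  apply: (tens_lin_ext (f := fun y => tmul (tmap (ract m) (ract n) (a ⊗ b)) y)
    (g := fun y => tmul (a ⊗ b) (tmap (lact m) (lact n) y))) => [||a' b'].
  + exact: br.
  + exact: linear_comp (br _) hl.
  by rewrite !tmap_pure// !tmul_pure mm nn.
Qed.

Definition mtens (m : multiplier A) (n : multiplier B) : multiplier (A ⊠ B) :=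
  mkmult (mtens_subproof m n).

End TensorMultiplier.

Notation "m ⊗ₘ n" := (mtens m n) (at level 38, left associativity)
  : walg_scope.

Section Transport.
Variables (K : fieldType) (A B : algebra K).

Record alg_iso := AlgIso {
  iso_fun : A -> B;
  iso_inv : B -> A;
  iso_linear : linear iso_fun;
  iso_mul : forall a a', iso_fun (a ∙ a') = iso_fun a ∙ iso_fun a';
  iso_funK : cancel iso_fun iso_inv;
  iso_invK : cancel iso_inv iso_fun
}.

Lemma mtransport_subproof (i : alg_iso) (m : multiplier A) :
  is_multiplier (fun b => iso_fun i (lact m (iso_inv i b)),
                 fun b => iso_fun i (ract m (iso_inv i b))).
Proof.
have [/= ml mr mll mrr mm] := multiplierP m.
have gl : linear (iso_inv i).
  move=> k x y; apply: (can_inj (iso_funK i)).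
  by rewrite iso_linear !iso_invK.
have gM x y : iso_inv i (x ∙ y) = iso_inv i x ∙ iso_inv i y.
  by apply: (can_inj (iso_funK i)); rewrite iso_mul !iso_invK.
split=> [||a b|a b|a b] /=.
- exact: linear_comp (@iso_linear i) (linear_comp ml gl).
- exact: linear_comp (@iso_linear i) (linear_comp mr gl).
- by rewrite gM mll iso_mul iso_invK.
- by rewrite gM mrr iso_mul iso_invK.
- by rewrite -{1}[b](iso_invK i) -{2}[a](iso_invK i) -!iso_mul mm.
Qed.

Definition mtransport (i : alg_iso) (m : multiplier A) : multiplier B :=
  mkmult (mtransport_subproof i m).

End Transport.

Section Flip.
Variables (K : fieldType).

Definition tflip (V W : lmodType K) (t : V ⊗ W) : W ⊗ V :=
  tlift (fun v w => w ⊗ v) t.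

Lemma flip_bil (V W : lmodType K) : is_bilinear (fun (v : V) (w : W) => w ⊗ v).
Proof.
by split=> ? ? ? ? /=; [apply: (tpure_bilinear _ _).2|apply: (tpure_bilinear _ _).1].
Qed.

Lemma tflip_linear (V W : lmodType K) : linear (@tflip V W).
Proof. exact: tlift_linear (@flip_bil V W). Qed.

Lemma tflip_pure (V W : lmodType K) (v : V) (w : W) : tflip (v ⊗ w) = w ⊗ v.
Proof. exact: tlift_pure (@flip_bil V W). Qed.

Lemma tflipK (V W : lmodType K) : cancel (@tflip V W) (@tflip W V).
Proof.
apply: tens_lin_ext => [||v w]; last by rewrite !tflip_pure.
  exact: linear_comp (@tflip_linear _ _) (@tflip_linear _ _).
exact: linear_id.
Qed.

Lemma tflip_mul (A B : algebra K) (x y : A ⊠ B) :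
  tflip (x ∙ y) = (tflip x : B ⊠ A) ∙ (tflip y : B ⊠ A).
Proof.
have [bl br] := @tmul_bilinear _ A B.
have [bl' br'] := @tmul_bilinear _ B A.
apply: (tens_lin_ext (f := fun x => tflip (tmul x y))
  (g := fun x => tmul (tflip x) (tflip y))) => [||a b].
- exact: linear_comp (@tflip_linear _ _) (bl _).
- exact: linear_comp (bl' _) (@tflip_linear _ _).
apply: (tens_lin_ext (f := fun y => tflip (tmul (a ⊗ b) y))
  (g := fun y => tmul (tflip (a ⊗ b)) (tflip y))) => [||a' b'].
- exact: linear_comp (@tflip_linear _ _) (br _).
- exact: linear_comp (br' _) (@tflip_linear _ _).
by rewrite tmul_pure !tflip_pure tmul_pure.
Qed.

Definition flip_iso (A B : algebra K) : alg_iso (A ⊠ B) (B ⊠ A) :=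
  @AlgIso K (A ⊠ B) (B ⊠ A) _ _ (@tflip_linear A B) (@tflip_mul A B) (@tflipK A B) (@tflipK B A).

End Flip.

Section Associator.
Variables (K : fieldType).

Section Lmod.
Variables (U V W : lmodType K).

Definition tassoc (t : (U ⊗ V) ⊗ W) : U ⊗ (V ⊗ W) :=
  tlift (fun s w => tlift (fun u v => u ⊗ (v ⊗ w)) s) t.

Definition tassocV (t : U ⊗ (V ⊗ W)) : (U ⊗ V) ⊗ W :=
  tlift (fun u s => tlift (fun v w => (u ⊗ v) ⊗ w) s) t.

Let assoc_in (w : W) : is_bilinear (fun (u : U) (v : V) => u ⊗ (v ⊗ w)).
Proof.
apply: (bilin_comp (@tpure_bilinear _ _ _) (@linear_id _ _)).
exact: (tpure_bilinear _ _).1.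
Qed.

Let assocV_in (u : U) : is_bilinear (fun (v : V) (w : W) => (u ⊗ v) ⊗ w).
Proof.
apply: (bilin_comp (@tpure_bilinear _ _ _) _ (@linear_id _ _)).
exact: (tpure_bilinear _ _).2.
Qed.

Let assoc_out : is_bilinear
  (fun (s : U ⊗ V) (w : W) => tlift (fun u v => u ⊗ (v ⊗ w)) s).
Proof.
split=> [w|s]; first exact: tlift_linear (assoc_in w).
apply: (tlift_param (F := fun w u v => u ⊗ (v ⊗ w))) => u v.
exact: linear_comp ((tpure_bilinear _ _).2 u) ((tpure_bilinear _ _).2 v).
Qed.

Let assocV_out : is_bilinear
  (fun (u : U) (s : V ⊗ W) => tlift (fun v w => (u ⊗ v) ⊗ w) s).
Proof.
split=> [s|u]; last exact: tlift_linear (assocV_in u).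
apply: (tlift_param (F := fun u v w => (u ⊗ v) ⊗ w)) => v w.
exact: linear_comp ((tpure_bilinear _ _).1 w) ((tpure_bilinear _ _).1 v).
Qed.

Lemma tassoc_linear : linear tassoc.
Proof. exact: tlift_linear assoc_out. Qed.
Lemma tassocV_linear : linear tassocV.
Proof. exact: tlift_linear assocV_out. Qed.

Lemma tassoc_pure u v w : tassoc ((u ⊗ v) ⊗ w) = u ⊗ (v ⊗ w).
Proof. by rewrite /tassoc !tlift_pure. Qed.
Lemma tassocV_pure u v w : tassocV (u ⊗ (v ⊗ w)) = (u ⊗ v) ⊗ w.
Proof. by rewrite /tassocV !tlift_pure. Qed.

Lemma tens3_ext (T : lmodType K) (f g : (U ⊗ V) ⊗ W -> T) :
  linear f -> linear g ->
  (forall u v w, f ((u ⊗ v) ⊗ w) = g ((u ⊗ v) ⊗ w)) -> f =1 g.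
Proof.
move=> lf lg fg; apply: tens_lin_ext => // s w.
by apply: (tens_lin_ext (f := fun s => f (s ⊗ w)) (g := fun s => g (s ⊗ w)))
  => //; apply: (linear_comp _ ((tpure_bilinear _ _).1 w)).
Qed.

Lemma tassocK : cancel tassoc tassocV.
Proof.
apply: tens3_ext => [||u v w]; last by rewrite tassoc_pure tassocV_pure.
  exact: linear_comp tassocV_linear tassoc_linear.
exact: linear_id.
Qed.

Lemma tassocVK : cancel tassocV tassoc.
Proof.
apply: tens_lin_ext => [||u s].
- exact: linear_comp tassoc_linear tassocV_linear.
- exact: linear_id.
apply: (tens_lin_ext (f := fun s => tassoc (tassocV (u ⊗ s)))
                     (g := fun s => u ⊗ s)) => [||v w].
- apply: (linear_comp (linear_comp tassoc_linear tassocV_linear)).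
  exact: (tpure_bilinear _ _).2.
- exact: (tpure_bilinear _ _).2.
by rewrite tassocV_pure tassoc_pure.
Qed.

End Lmod.

Lemma tassoc_mul (A B C : algebra K) (x y : (A ⊠ B) ⊠ C) :
  tassoc (x ∙ y) = (tassoc x : A ⊠ (B ⊠ C)) ∙ (tassoc y : A ⊠ (B ⊠ C)).
Proof.
have [bl br] := amul_bilinear ((A ⊠ B) ⊠ C).
have [bl' br'] := amul_bilinear (A ⊠ (B ⊠ C)).
have al := @tassoc_linear A B C.
apply: (tens3_ext (f := fun x => tassoc ((x : (A ⊠ B) ⊠ C) ∙ y))
  (g := fun x => (tassoc x : A ⊠ (B ⊠ C)) ∙ (tassoc y : A ⊠ (B ⊠ C))))
  => [||a b c].
- exact: linear_comp al (bl _).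
- exact: linear_comp (bl' _) al.
apply: (tens3_ext
  (f := fun y => tassoc (((a ⊗ b) ⊗ c : (A ⊠ B) ⊠ C) ∙ (y : (A ⊠ B) ⊠ C)))
  (g := fun y => (tassoc ((a ⊗ b) ⊗ c) : A ⊠ (B ⊠ C)) ∙
                 (tassoc y : A ⊠ (B ⊠ C)))) => [||a' b' c'].
- exact: linear_comp al (br _).
- exact: linear_comp (br' _) al.
by rewrite !tassoc_pure /= !tmul_pure /= !tmul_pure tassoc_pure.
Qed.

Definition assoc_iso (A B C : algebra K) :
    alg_iso ((A ⊠ B) ⊠ C) (A ⊠ (B ⊠ C)) :=
  @AlgIso K ((A ⊠ B) ⊠ C) (A ⊠ (B ⊠ C)) _ _ (@tassoc_linear A B C) (@tassoc_mul A B C)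
    (@tassocK A B C) (@tassocVK A B C).

End Associator.

Section WeakMultiplierHopfAlgebra.
Variables (K : fieldType) (A : algebra K).

Implicit Types (Delta : A -> multiplier (A ⊠ A)) (E : multiplier (A ⊠ A)).

Definition left_leg (a : A) : multiplier (A ⊠ A) := memb a ⊗ₘ 𝟙.
Definition right_leg (a : A) : multiplier (A ⊠ A) := 𝟙 ⊗ₘ memb a.

(* Δ(a)(1 ⊗ b), (a ⊗ 1)Δ(b), Δ(a)(b ⊗ 1) and (1 ⊗ a)Δ(b) as elements of A ⊗ A *)
Definition T1 Delta (a b : A) : A ⊗ A := munemb (Delta a · right_leg b).
Definition T2 Delta (a b : A) : A ⊗ A := munemb (left_leg a · Delta b).
Definition T3 Delta (a b : A) : A ⊗ A := munemb (Delta a · left_leg b).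
Definition T4 Delta (a b : A) : A ⊗ A := munemb (right_leg a · Delta b).

Definition is_homomorphism (B C : algebra K) (h : B -> multiplier C) : Prop :=
  linear h /\ forall b b', h (b ∙ b') = h b · h b'.

(* Sweedler-type expressions are written with tlift: if t = Σ p ⊗ q, then
   tlift (fun p q => F p q) t = Σ F p q. *)
Definition is_coproduct Delta : Prop :=
  [/\ is_homomorphism Delta,
      forall a b, in_algebra (Delta a · right_leg b),
      forall a b, in_algebra (left_leg a · Delta b)
    & forall a b c,
        tassoc (tlift (fun p q => T2 Delta c p ⊗ q) (T1 Delta a b)) =
        tlift (fun p q => p ⊗ T1 Delta q b) (T2 Delta c a)].

Definition is_full Delta : Prop :=
  (forall V : set A, is_subspace V ->
     (forall a b, lspan [set t | exists v c, V v /\ t = v ⊗ c] (T1 Delta a b)) ->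
     V = setT) /\
  (forall W : set A, is_subspace W ->
     (forall a b, lspan [set t | exists c w, W w /\ t = c ⊗ w] (T2 Delta a b)) ->
     W = setT).

Definition regular_coproduct Delta : Prop :=
  (forall a b, in_algebra (Delta a · left_leg b)) /\
  (forall a b, in_algebra (right_leg a · Delta b)).

Definition is_counit Delta (eps : A -> K^o) : Prop :=
  [/\ linear eps,
      forall a b, tlift (fun p q => eps p *: q) (T1 Delta a b) = a ∙ b
    & forall a b, tlift (fun p q => eps q *: p) (T2 Delta a b) = a ∙ b].

Definition id_tens_Delta Delta : A ⊗ A -> multiplier (A ⊠ (A ⊠ A)) :=
  tlift (fun a b => memb a ⊗ₘ Delta b).

(* X is the value at m of the extension of h to M(B) with h(1) = e. *)
Definition is_extension_value (B C : algebra K) (h : B -> multiplier C)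
    (e : multiplier C) (m : multiplier B) (X : multiplier C) : Prop :=
  [/\ X · e = X, e · X = X,
      forall b, X · h b = h (lact m b)
    & forall b, h b · X = h (ract m b)].

(* E ⊗ 1 and 1 ⊗ E in M(A ⊗ (A ⊗ A)) *)
Definition E12 E : multiplier (A ⊠ (A ⊠ A)) :=
  mtransport (assoc_iso A A A) (E ⊗ₘ 𝟙).
Definition E23 E : multiplier (A ⊠ (A ⊠ A)) := 𝟙 ⊗ₘ E.

(* If T1 a c = Σ p ⊗ q, then Δ₁₃(a)(1 ⊗ b ⊗ c) = Σ p ⊗ b ⊗ q, and
   Δ₁₃(a)(1 ⊗ E)(1 ⊗ b ⊗ c) is the sum of the Δ₁₃(a)(1 ⊗ b' ⊗ c') over
   E(b ⊗ c) = Σ b' ⊗ c'. *)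
Definition is_G1 Delta E (G : A ⊗ A -> A ⊗ A) : Prop :=
  linear G /\
  forall a b c,
    tlift (fun p q => G (p ⊗ b) ⊗ q) (T1 Delta a c) =
    tlift (fun b' c' => tlift (fun p q => (p ⊗ b') ⊗ q) (T1 Delta a c'))
      (lact E (b ⊗ c)).

Definition is_G2 Delta E (G : A ⊗ A -> A ⊗ A) : Prop :=
  linear G /\
  forall a b c,
    tlift (fun p q => p ⊗ G (b ⊗ q)) (T2 Delta a c) =
    tlift (fun a' b' => tlift (fun p q => p ⊗ (b' ⊗ q)) (T2 Delta a' c))
      (ract E (a ⊗ b)).

Definition lker (V W : lmodType K) (f : V -> W) : set V := [set v | f v = 0].

Definition canonical_idempotent Delta E : Prop :=
  [/\ E · E = E,
      range (tlift (T1 Delta)) = range (lact E) /\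
      range (tlift (T2 Delta)) = range (ract E),
      is_extension_value (B := A ⊠ A) (id_tens_Delta Delta) (E23 E) E (E12 E · E23 E) /\
      E12 E · E23 E = E23 E · E12 E
    & exists G1 G2, [/\ is_G1 Delta E G1, is_G2 Delta E G2,
        lker (tlift (T1 Delta)) = range (fun t => t - G1 t)
      & lker (tlift (T2 Delta)) = range (fun t => t - G2 t)]].

Definition weak_multiplier_hopf Delta : Prop :=
  [/\ nondegenerate A, idempotent_algebra A,
      is_coproduct Delta /\ is_full Delta,
      exists eps, is_counit Delta eps
    & exists E, canonical_idempotent Delta E].

Definition Delta_cop Delta (a : A) : multiplier (A ⊠ A) :=
  mtransport (flip_iso A A) (Delta a).

Definition regular_weak_multiplier_hopf Delta : Prop :=
  [/\ weak_multiplier_hopf Delta, regular_coproduct Delta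
    & weak_multiplier_hopf (Delta_cop Delta)].

(* R1 and R2 are determined by (c ⊗ 1)R1(a ⊗ b) = Σ c a₍₁₎ ⊗ S(a₍₂₎)b and
   R2(a ⊗ b)(1 ⊗ c) = Σ a S(b₍₁₎) ⊗ b₍₂₎c. *)
Definition is_antipode Delta E (S : A -> multiplier A) : Prop :=
  [/\ linear S, forall a b, S (a ∙ b) = S b · S a
    & exists G1 G2 R1 R2,
      [/\ is_G1 Delta E G1 /\ is_G2 Delta E G2,
          linear R1 /\ linear R2,
          (forall a b c, lact (left_leg c) (R1 (a ⊗ b)) =
             tlift (fun p q => p ⊗ lact (S q) b) (T2 Delta c a)) /\
          (forall a b c, ract (right_leg c) (R2 (a ⊗ b)) =
             tlift (fun p q => ract (S p) a ⊗ q) (T1 Delta b c)),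
          (forall t, tlift (T1 Delta) (R1 t) = lact E t) /\
          (forall t, R1 (tlift (T1 Delta) t) = G1 t)
        & (forall t, tlift (T2 Delta) (R2 t) = ract E t) /\
          (forall t, R2 (tlift (T2 Delta) t) = G2 t)]].

End WeakMultiplierHopfAlgebra.

Section AlgebraicQuantumGroupoid.
Variables (K : fieldType) (A : algebra K) (Delta : A -> multiplier (A ⊠ A)).

Definition target_algebra : set (multiplier A) :=
  [set x | forall a c, T2 Delta c (lact x a) = T2 Delta (ract x c) a].

Definition left_integral (phi : A -> K^o) : Prop :=
  [/\ linear phi, exists a, phi a != 0
    & forall a, exists x : multiplier A,
      [/\ target_algebra x,
          forall b, lact x b = tlift (fun p q => phi q *: p) (T3 Delta a b)
        & forall b, ract x b = tlift (fun p q => phi q *: p) (T2 Delta b a)]].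

Definition algebraic_quantum_groupoid : Prop :=
  [/\ regular_weak_multiplier_hopf Delta,
      forall x, (forall phi a, left_integral phi -> phi (x ∙ a) = 0) -> x = 0
    & forall x, (forall phi a, left_integral phi -> phi (a ∙ x) = 0) -> x = 0].

(* The regular weak multiplier Hopf algebra (B, DeltaB) is the dual of A, its
   elements being viewed as functionals on A by ev, with ev b a = <a, b>. *)
Record is_dual (B : algebra K) (DeltaB : B -> multiplier (B ⊠ B))
    (ev : B -> A -> K^o) : Prop := IsDual {
  dual_regular : regular_weak_multiplier_hopf DeltaB;
  dual_ev_linear : linear ev;
  dual_ev_inj : injective ev;
  dual_ev_range : range ev =
    lspan [set w : A -> K^o | exists phi a,
             left_integral phi /\ w = (fun x => phi (a ∙ x))];
  (* (ω ω')(x) = (φ ⊗ φ')((a ⊗ a')Δ(x)) for ω = φ(a ·) and ω' = φ'(a' ·) *)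
  dual_mul : forall (w w' : B) (phi phi' : A -> K^o) (a a' x : A),
    left_integral phi -> left_integral phi' ->
    ev w = (fun y => phi (a ∙ y)) -> ev w' = (fun y => phi' (a' ∙ y)) ->
    ev (w ∙ w') x =
      tlift (fun p q => phi p * phi' q : K^o) (ract (Delta x) (a ⊗ a'));
  dual_T1 : forall (x y : A) (w w' : B),
    tlift (fun p q => ev p x * ev q y : K^o) (T1 DeltaB w w') =
    tlift (fun p q => ev w p * ev w' q : K^o) (T2 Delta x y);
  dual_T2 : forall (x y : A) (w w' : B),
    tlift (fun p q => ev p x * ev q y : K^o) (T2 DeltaB w w') =
    tlift (fun p q => ev w p * ev w' q : K^o) (T1 Delta x y)
}.

End AlgebraicQuantumGroupoid.

Section SmashProduct.
Variables (K : fieldType) (A : algebra K) (Delta : A -> multiplier (A ⊠ A)).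
Variables (B : algebra K) (DeltaB : B -> multiplier (B ⊠ B)).
Variables (ev : B -> A -> K^o).

(* b ▷ a = Σ a₍₁₎ <a₍₂₎, b>, the element x of A with
   c x = Σ c a₍₁₎ <a₍₂₎, b> for all c *)
Definition dact (b : B) (a : A) : A :=
  xget 0 [set x | forall c,
    c ∙ x = tlift (fun p q => ev b q *: p) (T2 Delta c a)].

Definition smash_mul (z z' : A ⊗ B) : A ⊗ B :=
  tlift (fun a b => tlift (fun a' b' =>
    tlift (fun p q => (a ∙ dact p a') ⊗ q) (T1 DeltaB b b')) z') z.

Definition tens_act (t : B ⊗ B) (z : A ⊗ B) : A ⊗ B :=
  tlift (fun p q => tlift (fun a b => dact p a ⊗ (q ∙ b)) z) t.

(* The extension of tens_act to multipliers: m ▷ Σ tᵢ ▷ zᵢ = Σ (m tᵢ) ▷ zᵢ. *)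
Definition mult_act (m : multiplier (B ⊠ B)) (z : A ⊗ B) : A ⊗ B :=
  xget 0 [set w | exists s : seq ((B ⊗ B) * (A ⊗ B)),
    z = \sum_(p <- s) tens_act p.1 p.2 /\
    w = \sum_(p <- s) tens_act (lact m p.1) p.2].

Definition smash_sub (EB : multiplier (B ⊠ B)) : set (A ⊗ B) :=
  range (mult_act EB).

(* (a # b) a' = Σ a a'₍₁₎ <a'₍₂₎, b> *)
Definition smash_act (z : A ⊗ B) (a' : A) : A :=
  tlift (fun a b => tlift (fun p q => ev b q *: p) (T2 Delta a a')) z.

(* aS(E₍₁₎) ⊗ E₍₂₎c = S(E₍₁₎S⁻¹(a)) ⊗ E₍₂₎c *)
Definition SE (E : multiplier (A ⊠ A)) (S Sinv : A -> A) (a c : A) : A ⊗ A :=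
  tmap S id (lact E (Sinv a ⊗ c)).

Definition integral_operator (E : multiplier (A ⊠ A)) (S Sinv : A -> A)
    (phi : A -> K^o) (a c : A) : A -> A :=
  fun a' => tlift (fun p q => phi (q ∙ a') *: p) (SE E S Sinv a c).

End SmashProduct.

(* Main.v *)
Require Import Defs.
From HB Require Import structures.
From mathcomp Require Import all_boot all_order all_algebra.
From mathcomp Require Import boolp classical_sets functions reals.
From mathcomp Require Import complex.

Set Implicit Arguments.
Unset Strict Implicit.
Unset Printing Implicit Defensive.

Import GRing.Theory.
Local Open Scope ring_scope.
Local Open Scope classical_set_scope.
Local Open Scope walg_scope.

(** Write b ▷ x = Σ x₍₁₎<x₍₂₎, b>, so that a # b acts on A as x ↦ a(b ▷ x).

A is a module algebra over its dual: the product (x, y) ↦ xy intertwines the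
action of Δ̂(b) with that of b ([T1_dact]). Since Δ̂(b)Ê = Δ̂(b) and the dual acts
faithfully, the product does not see Ê ([dact_lactEB]); therefore Ê ▷ (a # b) and
a # b are the same operator ([smash_act_mult_act]). The module algebra property
also gives the multiplicativity of the action ([smash_act_mul]).

It remains to describe the span of the operators x ↦ a(b ▷ x). For b = φ(c ·) the
value at x is (ι ⊗ φ)(tΔ(x)) with t = a ⊗ c. Since Δ(x) = EΔ(x), only tE matters,
and (A ⊗ A)E is the span of the elements (a ⊗ 1)Δ(c). So the span is that of the
operators x ↦ (ι ⊗ φ)((a ⊗ 1)Δ(cx)), and the theorem becomes the formula
aS(E₍₁₎)φ(E₍₂₎c) = (ι ⊗ φ)((a ⊗ 1)Δ(c)) for left integrals φ ([antipode_integral]),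
applied with cx in place of c.

This formula has two ingredients. One is S(E₍₁₎)E₍₂₎ = 1 ([antipode_lactE]), which
uses that S is a bijective anti-homomorphism with
E(c ⊗ 1) = Σ c₍₁₎ ⊗ c₍₂₎S(c₍₃₎), and that E is idempotent. The other is left
invariance in the form Σ b₍₁₎ ⊗ b₍₂₎φ(b₍₃₎) = E(y ⊗ 1), where y = (ι ⊗ φ)Δ(b) lies
in A_t ([slice_tens]). The two are combined on the elements Δ(c)(b ⊗ 1), which
span E(A ⊗ A) by the axioms for the coopposite algebra ([lactE_range_T3]).

Sweedler sums with several legs are handled as iterated sums [tlift], one leg
being cut at a time. Identities are checked after covering legs by elements of A
and are then freed from these factors: the functionals φ(· a) separate the points
of A, hence the tensor powers of A are separated by functionals and
non-degenerate. *)

(** * Linearity of unbundled maps *)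

(** The predicates below repeat [linear] and [bilinear_for] with the scaling laws
hidden, so that every goal met by the proof search [lin] has the same
syntactic shape, whichever structures the spaces carry. *)
Definition lin_map (K : fieldType) (V W : lmodType K) (f : V -> W) : Prop :=
  linear f.

Definition bilin_map (K : fieldType) (U V W : lmodType K) (h : U -> V -> W) :
    Prop :=
  (forall v, lin_map (fun u => h u v)) /\ (forall u, lin_map (fun v => h u v)).

Definition trilin_map (K : fieldType) (U V W X : lmodType K)
    (h : U -> V -> W -> X) : Prop :=
  [/\ forall v w, lin_map (fun u => h u v w),
      forall u w, lin_map (fun v => h u v w)
    & forall u v, lin_map (fun w => h u v w)].

Section LinearMaps.
Variables (K : fieldType) (U V : lmodType K) (f : U -> V).
Hypothesis lf : lin_map f.

Lemma linear0E : f 0 = 0.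
Proof. by have := lf (-1) 0 0; rewrite scaler0 addr0 scaleN1r addNr. Qed.

Lemma linearDE x y : f (x + y) = f x + f y.
Proof. by have := lf 1 x y; rewrite !scale1r. Qed.

Lemma linearZE k x : f (k *: x) = k *: f x.
Proof. by have := lf k x 0; rewrite linear0E !addr0. Qed.

Lemma linearBE x y : f (x - y) = f x - f y.
Proof. by rewrite linearDE -scaleN1r linearZE scaleN1r. Qed.

Lemma linear_sumE (I : Type) (s : seq I) (F : I -> U) :
  f (\sum_(i <- s) F i) = \sum_(i <- s) f (F i).
Proof. exact: (big_morph f linearDE linear0E). Qed.

End LinearMaps.

Section LinearMapRules.
Variable K : fieldType.
Implicit Types U V W X : lmodType K.

Lemma bilin_mapE U V W (h : U -> V -> W) : bilin_map h <-> is_bilinear h.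
Proof. by split=> [[]|[]]. Qed.

Lemma lin_id V : lin_map (fun x : V => x).
Proof. by []. Qed.

Lemma lin_scale V W (k : K) (f : V -> W) :
  lin_map f -> lin_map (fun x => k *: f x).
Proof. by move=> lf c x y; rewrite lf scalerDr !scalerA mulrC. Qed.

Lemma lin_scalel V W (w : W) (f : V -> K^o) :
  lin_map f -> lin_map (fun x => (f x : K) *: w).
Proof. by move=> lf c x y; rewrite lf scalerDl scalerA. Qed.

Lemma lin_mull V (w : K^o) (f : V -> K^o) :
  lin_map f -> lin_map (fun x => f x * w : K^o).
Proof. by move=> lf c x y; rewrite lf mulrDl scalerAl. Qed.

Lemma lin_mulr V (w : K^o) (f : V -> K^o) :
  lin_map f -> lin_map (fun x => w * f x : K^o).
Proof. by move=> lf c x y; rewrite lf mulrDr scalerAr. Qed.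

Lemma lin_add V W (f g : V -> W) :
  lin_map f -> lin_map g -> lin_map (fun x => f x + g x).
Proof. by move=> lf lg c x y; rewrite lf lg scalerDr addrACA. Qed.

Lemma lin_opp V W (f : V -> W) : lin_map f -> lin_map (fun x => - f x).
Proof. by move=> lf c x y; rewrite lf opprD scalerN. Qed.

Lemma lin_comp U V W (h : V -> W) (f : U -> V) :
  lin_map h -> lin_map f -> lin_map (fun x => h (f x)).
Proof. by move=> lh lf c x y; rewrite lf lh. Qed.

Lemma lin_bil_l U V W X (h : U -> V -> W) (f : X -> U) v :
  bilin_map h -> lin_map f -> lin_map (fun x => h (f x) v).
Proof. by move=> hb lf c x y; rewrite lf hb.1. Qed.

Lemma lin_bil_r U V W (h : U -> V -> W) u :
  bilin_map h -> lin_map (h u).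
Proof. by move=> hb c x y; rewrite hb.2. Qed.

Lemma lin_tlift U V W (h : U -> V -> W) : bilin_map h -> lin_map (tlift h).
Proof. by move=> /bilin_mapE hb; apply: tlift_linear. Qed.

Lemma lin_tlift_body U V W X (F : X -> U -> V -> W) t :
  (forall u v, lin_map (fun x => F x u v)) -> lin_map (fun x => tlift (F x) t).
Proof. by move=> hF; apply: tlift_param hF. Qed.

Lemma bilinI U V W (h : U -> V -> W) :
  (forall v, lin_map (fun u => h u v)) -> (forall u, lin_map (fun v => h u v)) ->
  bilin_map h.
Proof. by split. Qed.

Lemma bilin_tpure V W : bilin_map (@tpure K V W).
Proof. exact/bilin_mapE/tpure_bilinear. Qed.

Lemma bilin_amul (A : algebra K) : bilin_map (@amul K A).
Proof. exact/bilin_mapE/amul_bilinear. Qed.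

Lemma lin_tmap U V U' V' (f : U -> U') (g : V -> V') :
  lin_map f -> lin_map g -> lin_map (tmap f g).
Proof. exact: tmap_linear. Qed.

Lemma lin_lact (A : algebra K) (m : multiplier A) : lin_map (lact m).
Proof. by have [] := multiplierP m. Qed.

Lemma lin_ract (A : algebra K) (m : multiplier A) : lin_map (ract m).
Proof. by have [] := multiplierP m. Qed.

Lemma lin_tflip V W : lin_map (@tflip K V W).
Proof. exact: tflip_linear. Qed.

End LinearMapRules.

(** [lin] proves that a function given by an expression is linear, bilinear or
trilinear: it descends through sums, scalings, products, pure tensors and
[tlift], and ends on the hypotheses and on the hint database [lin]. *)
Create HintDb lin discriminated.
#[global] Hint Resolve bilin_tpure bilin_amul lin_id lin_lact lin_ract
  lin_tflip : lin.

Ltac lin_base := solve [ typeclasses eauto 4 with lin nocore ].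
Ltac lin :=
  cbv beta;
  lazymatch goal with
  | |- forall _, _ => let x := fresh "x" in intro x; lin
  | |- GRing.linear_for _ ?f => change (lin_map f); lin
  | |- trilin_map _ => first [ lin_base | split; lin ]
  | |- bilin_map ?h =>
      first [ lin_base
            | apply: bilinI; [ let x := fresh "x" in intro x; lin
                             | let x := fresh "x" in intro x; lin ] ]
  | |- lin_map ?f =>
      first [ lin_base
            | lazymatch f with
              | fun x => _ => lin_expr
              | tlift ?F => refine (@lin_tlift _ _ _ _ F _); lin
              | tmap ?g ?h => refine (@lin_tmap _ _ _ _ _ g h _ _); lin
              | ?h ?u => refine (@lin_bil_r _ _ _ _ h u _); lin_base
              end ]
  end
with lin_expr :=
  first
  [ refine (@lin_id _ _)
  | match goal with
    | |- @lin_map ?K _ _ (fun x => tlift (@?F x) ?t) =>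
        let u := fresh "u" in let v := fresh "v" in
        refine (@lin_tlift_body K _ _ _ _ F t _); intros u v; lin
    | |- @lin_map ?K _ _ (fun x => ?k *: (@?f x)) =>
        refine (@lin_scale K _ _ k f _); lin
    | |- @lin_map ?K _ _ (fun x => (@?f x) *: ?k) =>
        refine (@lin_scalel K _ _ k f _); lin
    | |- @lin_map ?K _ _ (fun x => (@?f x) * ?k) =>
        refine (@lin_mull K _ k f _); lin
    | |- @lin_map ?K _ _ (fun x => ?k * (@?f x)) =>
        refine (@lin_mulr K _ k f _); lin
    | |- @lin_map ?K _ _ (fun x => (@?f x) + (@?g x)) =>
        refine (@lin_add K _ _ f g _ _); lin
    | |- @lin_map ?K _ _ (fun x => - (@?f x)) => refine (@lin_opp K _ _ f _); lin
    | |- @lin_map ?K _ _ (fun x => ?h (@?f x) ?c) =>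
        refine (@lin_bil_l K _ _ _ _ h f c _ _); [ lin_base | lin ]
    | |- @lin_map ?K _ _ (fun x => ?h (@?f x)) =>
        lazymatch f with
        | fun x => x => change (lin_map h); lin
        | _ => refine (@lin_comp K _ _ _ h f _ _); lin
        end
    end ].

(** * Sums over tensors, spans and separating functionals *)

Section TensorSums.
Variable K : fieldType.
Implicit Types U V W X : lmodType K.

(** [tlift F t] is a finite sum over a representative of [t], so a linear map
goes through it term by term. *)
Lemma tlift_map U V W X (g : W -> X) (F : U -> V -> W) t :
  lin_map g -> g (tlift F t) = tlift (fun u v => g (F u v)) t.
Proof. by move=> lg; rewrite /tlift /formal_eval (linear_sumE lg). Qed.

Lemma eq_tlift U V W (F G : U -> V -> W) t :
  (forall u v, F u v = G u v) -> tlift F t = tlift G t.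
Proof. by move=> FG; apply: eq_bigr. Qed.

Lemma tliftB U V W (F G : U -> V -> W) t :
  tlift (fun u v => F u v - G u v) t = tlift F t - tlift G t.
Proof. by rewrite /tlift /formal_eval sumrB. Qed.

Lemma tlift0 U V W (t : U ⊗ V) : tlift (fun _ _ => 0 : W) t = 0.
Proof. by rewrite /tlift /formal_eval big1. Qed.

Lemma tlift_exchange U V U' V' W (F : U -> V -> U' -> V' -> W) s t :
  tlift (fun u v => tlift (F u v) t) s =
  tlift (fun u' v' => tlift (fun u v => F u v u' v') s) t.
Proof. exact: exchange_big. Qed.

(** Bilinearity enters here: the representative of a pure tensor can be any list
equivalent to the expected one. *)
Lemma tliftE U V W (F : U -> V -> W) u v :
  bilin_map F -> tlift F (u ⊗ v) = F u v.
Proof. by move=> /bilin_mapE Fb; apply: tlift_pure. Qed.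

Lemma tlift_tlift U V U' V' W (F : U' -> V' -> W) (G : U -> V -> U' ⊗ V') t :
  bilin_map F -> tlift F (tlift G t) = tlift (fun u v => tlift F (G u v)) t.
Proof. by move=> Fb; apply: tlift_map; lin. Qed.

Lemma tlift_pures U V U' V' W (F : U' -> V' -> W) (a : U -> V -> U')
    (b : U -> V -> V') t :
  bilin_map F ->
  tlift F (tlift (fun u v => a u v ⊗ b u v) t) =
  tlift (fun u v => F (a u v) (b u v)) t.
Proof.
by move=> Fb; rewrite tlift_tlift//; apply: eq_tlift => u v; rewrite tliftE.
Qed.

Lemma tlift_tpure U V (t : U ⊗ V) : tlift (fun u v => u ⊗ v) t = t.
Proof. by rewrite [RHS]tens_pureE. Qed.

Lemma tens_ext_lin U V W (f g : U ⊗ V -> W) :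
  lin_map f -> lin_map g -> (forall u v, f (u ⊗ v) = g (u ⊗ v)) -> f =1 g.
Proof. exact: tens_lin_ext. Qed.

Lemma tlift_tmap U V U' V' W (F : U' -> V' -> W) (f : U -> U') (g : V -> V') t :
  bilin_map F -> lin_map f -> lin_map g ->
  tlift F (tmap f g t) = tlift (fun u v => F (f u) (g v)) t.
Proof.
move=> Fb lf lg; rewrite /tmap tlift_tlift//.
by apply: eq_tlift => u v; rewrite tliftE.
Qed.

Lemma tmapE U V U' V' (f : U -> U') (g : V -> V') u v :
  lin_map f -> lin_map g -> tmap f g (u ⊗ v) = f u ⊗ g v.
Proof. exact: tmap_pure. Qed.

Lemma tlift_tflip U V W (F : V -> U -> W) (t : U ⊗ V) :
  bilin_map F -> tlift F (tflip t) = tlift (fun u v => F v u) t.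
Proof.
move=> Fb; rewrite /tflip tlift_tlift//.
by apply: eq_tlift => u v; rewrite tliftE.
Qed.

End TensorSums.

Section LinearSpans.
Variables (K : fieldType) (V : lmodType K).

Lemma lspan_sub (X : set V) x : X x -> lspan X x.
Proof.
move=> Xx; exists [:: (1, x)]; split; last by rewrite big_seq1 scale1r.
by move=> p; rewrite inE => /eqP ->.
Qed.

Lemma lspan_subspace (X : set V) : is_subspace (lspan X).
Proof.
split; first by exists [::]; split => //; rewrite big_nil.
move=> k u v [s [sX ->]] [s' [s'X ->]].
exists ([seq (k * p.1, p.2) | p <- s] ++ s'); split.
  move=> p; rewrite mem_cat => /orP[/mapP[q qs ->]|/s'X //].
  exact: (sX q qs).
rewrite big_cat big_map scaler_sumr /=; congr (_ + _).
by apply: eq_bigr => p _; rewrite scalerA.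
Qed.

Lemma subspace_sum (X : set V) (I : Type) (s : seq I) (k : I -> K) (F : I -> V) :
  is_subspace X -> (forall i, X (F i)) -> X (\sum_(i <- s) k i *: F i).
Proof.
move=> [X0 XD] XF; elim: s => [|i s IH]; first by rewrite big_nil.
by rewrite big_cons; apply: XD.
Qed.

Lemma subspace_tlift (X : set V) (U W : lmodType K) (F : U -> W -> V) t :
  is_subspace X -> (forall u w, X (F u w)) -> X (tlift F t).
Proof.
move=> hX XF; rewrite /tlift /formal_eval.
under eq_bigr do rewrite -[F _ _]scale1r.
exact: subspace_sum.
Qed.

Lemma lspan_min (X Y : set V) :
  is_subspace Y -> X `<=` Y -> lspan X `<=` Y.
Proof.
move=> [Y0 YD] XY _ [s [sX ->]]; elim: s sX => [|p s IH] sX.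
  by rewrite big_nil.
rewrite big_cons; apply: YD; first by apply/XY/sX; rewrite mem_head.
by apply: IH => q qs; apply: sX; rewrite inE qs orbT.
Qed.

End LinearSpans.

Lemma range_subspace (K : fieldType) (V W : lmodType K) (f : V -> W) :
  lin_map f -> is_subspace (range f).
Proof.
move=> lf; split; first by exists 0 => //; exact: linear0E.
by move=> k _ _ [x _ <-] [y _ <-]; exists (k *: x + y); rewrite // lf.
Qed.

Section Separation.
Variable K : fieldType.

Definition separates (U : lmodType K) (F : set (U -> K^o)) : Prop :=
  (forall f, F f -> lin_map f) /\
  (forall u, (forall f, F f -> f u = 0) -> u = 0).

(** Over a general vector space this needs a choice of basis; for the algebras
considered here the integrals, or the pairing, provide the functionals. *)
Definition separated (U : lmodType K) : Prop :=
  separates [set f : U -> K^o | lin_map f].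

Lemma separatesW (U : lmodType K) (F : set (U -> K^o)) :
  separates F -> separated U.
Proof.
by move=> [lF sF]; split=> // u u0; apply: sF => f /lF; apply: u0.
Qed.

(** Induction on the length of a representation t = Σᵢ uᵢ ⊗ wᵢ. If f(u₁) ≠ 0,
then v = Σᵢ f(uᵢ)wᵢ lies in V, and eliminating w₁ gives
t = f(u₁)⁻¹u₁ ⊗ v + Σ_{i>1} (uᵢ - f(uᵢ)f(u₁)⁻¹u₁) ⊗ wᵢ,
where the last sum is shorter and still has all its slices in V. This replaces
any recourse to bases of U and W. *)
Lemma tens_slice_span (U W : lmodType K) (F : set (U -> K^o)) (V : set W) t :
  separates F -> is_subspace V ->
  (forall f, F f -> V (tlift (fun u w => f u *: w) t)) ->
  lspan [set x : U ⊗ W | exists c w, V w /\ x = c ⊗ w] t.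
Proof.
move=> [lF sF] hV; set P := [set x | _].
have hP := lspan_subspace P.
have bF f : F f -> bilin_map (fun u (w : W) => (f u : K) *: w).
  by move=> /lF lf; lin.
have VD u v : V u -> V v -> V (u + v).
  by move=> hu hv; rewrite -[u]scale1r; apply: hV.2.
have VZ k u : V u -> V (k *: u).
  by move=> hu; rewrite -[_ *: _]addr0; apply: hV.2 => //; exact: hV.1.
rewrite (tens_pureE t); set s := repr t.
elim: {t s} (size s) {-2}s (leqnn (size s)) => [|n IH] [|[u w] s] //=.
- by move=> _ _; rewrite big_nil; exact: hP.1.
- by move=> _ _; rewrite big_nil; exact: hP.1.
rewrite ltnS big_cons /= => sn hs.
have [u0|/eqP/eqP u0] := pselect (u = 0).
  rewrite u0 (linear0E (f := fun x => x ⊗ w)); last by lin.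
  rewrite add0r; apply: IH => // f Ff; have := hs f Ff.
  by rewrite u0 (linear0E (f := fun x => x ⊗ w)) ?add0r//; lin.
have [f Ff fu] : exists2 f, F f & f u != 0.
  apply: contrapT => nf; apply: u0; apply: sF => f Ff.
  by apply: contrapT => /eqP fu; apply: nf; exists f.
set sl := fun g : U -> K^o => \sum_(p <- s) (g p.1 : K) *: p.2.
have slE g : F g -> tlift (fun u w => g u *: w) (u ⊗ w + \sum_(p <- s) p.1 ⊗ p.2)
    = g u *: w + sl g.
  move=> Fg; rewrite (linearDE (lin_tlift (bF g Fg))) tliftE; last exact: bF.
  congr (_ + _); rewrite (linear_sumE (lin_tlift (bF g Fg))).
  by apply: eq_bigr => p _; rewrite tliftE//; exact: bF.
set v0 := f u *: w + sl f.
have Vv0 : V v0 by rewrite /v0 -slE//; exact: hs.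
set s' := [seq (p.1 - (f p.1 / f u) *: u, p.2) | p <- s].
have -> : u ⊗ w + \sum_(p <- s) p.1 ⊗ p.2 =
    (f u : K)^-1 *: (u ⊗ v0) + \sum_(p <- s') p.1 ⊗ p.2.
  rewrite /s' big_map /= /v0 (linearDE (lin_bil_r u (bilin_tpure U W))).
  rewrite (linearZE (lin_bil_r u (bilin_tpure U W))) scalerDr scalerA mulVf//.
  rewrite scale1r -addrA; congr (_ + _).
  rewrite /sl (linear_sumE (lin_bil_r u (bilin_tpure U W))) scaler_sumr.
  rewrite -big_split /=; apply: eq_bigr => -[a b] _ /=.
  rewrite (linearBE (f := fun x => x ⊗ b)); last by lin.
  rewrite (linearZE (f := fun x => x ⊗ b)); last by lin.
  rewrite (linearZE (lin_bil_r u (bilin_tpure U W))) scalerA.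
  by rewrite [_^-1 * _]mulrC addrCA subrr addr0.
apply: hP.2.
  by apply: lspan_sub; exists u, v0.
apply: IH; first by rewrite size_map.
move=> g Fg; rewrite (linear_sumE (lin_tlift (bF g Fg))) big_map /=.
have -> : \sum_(p <- s) tlift (fun u w => g u *: w)
      ((p.1 - (f p.1 / f u) *: u) ⊗ p.2) =
    (g u *: w + sl g) + (- (g u / f u)) *: v0.
  rewrite (eq_bigr (fun p => g p.1 *: p.2 + (- (g u / f u)) *: (f p.1 *: p.2))).
    rewrite big_split /= -scaler_sumr -/(sl g) -/(sl f) /v0 scalerDr.
    by rewrite scalerA mulNr divfK// scaleNr addrACA subrr add0r.
  move=> p _; rewrite (tliftE _ _ (bF g Fg)).
  rewrite (linearBE (lF g Fg)) (linearZE (lF g Fg)) scalerBl; congr (_ + _).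
  rewrite scalerA mulNr scaleNr; congr (- (_ *: _)).
  rewrite -[LHS]/(f p.1 / f u * g u : K) mulrAC [RHS]mulrAC.
  by rewrite [f p.1 * g u]mulrC.
by apply: (VD) => //; [rewrite -slE//; apply: hs | apply: VZ].
Qed.

Lemma tens_slice_eq0 (U W : lmodType K) (F : set (U -> K^o)) (t : U ⊗ W) :
  separates F -> (forall f, F f -> tlift (fun u w => f u *: w) t = 0) -> t = 0.
Proof.
move=> sF t0.
have h0 : @is_subspace _ W [set 0].
  by split=> // k u v -> ->; rewrite scaler0 addr0.
have := tens_slice_span sF h0 t0.
apply: (@lspan_min _ _ _ [set 0]).
  by split=> // k u v -> ->; rewrite scaler0 addr0.
move=> _ [u [_ [-> ->]]]; exact: linear0E (lin_bil_r u (bilin_tpure U W)).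
Qed.

Lemma separates_tens (U W : lmodType K) (F : set (U -> K^o)) (G : set (W -> K^o)) :
  separates F -> separates G ->
  separates [set h : U ⊗ W -> K^o | exists f g,
     [/\ F f, G g & h = tlift (fun u w => f u * g w : K^o)]].
Proof.
move=> sF sG; split=> [_ [f [g [/sF.1 lf /sG.1 lg ->]]]|t t0].
  by apply: lin_tlift; lin.
apply: (tens_slice_eq0 sF) => f Ff; apply: sG.2 => g Gg.
have lg := sG.1 g Gg; rewrite (tlift_map _ _ lg).
under eq_tlift do rewrite (linearZE lg).
by apply: t0; exists f, g.
Qed.

Lemma separated_tens (U W : lmodType K) :
  separated U -> separated W -> separated (U ⊗ W)%type.
Proof. by move=> sU sW; apply: separatesW (separates_tens sU sW). Qed.

(** Cancellation in a tensor product: when the maps [g i] are jointly injective, so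
are the maps g i ⊗ ι. The functionals h ∘ g i, with h a functional on U',
separate U, and [tens_slice_eq0] applies. *)
Lemma tens_cancel_l (U U' W : lmodType K) (I : Type) (g : I -> U -> U') :
  separated U' -> (forall i, lin_map (g i)) ->
  (forall u, (forall i, g i u = 0) -> u = 0) ->
  forall t t' : U ⊗ W,
    (forall i, tlift (fun u w => g i u ⊗ w) t = tlift (fun u w => g i u ⊗ w) t')
  -> t = t'.
Proof.
move=> sU' lg ginj t t' tt'; apply/eqP; rewrite -subr_eq0; apply/eqP.
apply: (@tens_slice_eq0 _ _
  [set f | exists i h, @lin_map _ U' _ h /\ f = (fun u => h (g i u))]).
  split=> [_ [i [h [lh ->]]]|u u0]; first by have lgi := lg i; lin.
  apply: ginj => i; apply: sU'.2 => h lh.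
  by apply: (u0 (fun u => h (g i u))); exists i, h.
move=> _ [i [h [lh ->]]]; have lgi := lg i.
have -> : forall x, tlift (fun u (w : W) => h (g i u) *: w) x =
    tlift (fun u w => h u *: w) (tlift (fun u w => g i u ⊗ w) x).
  by move=> x; rewrite tlift_tlift; [apply: eq_tlift => u w; rewrite tliftE//; lin|lin].
rewrite (linearBE (f := fun x => tlift (fun u w => g i u ⊗ w) x)); last by lin.
by rewrite tt' subrr; apply: (linear0E (f := tlift _)); lin.
Qed.

Lemma tens_cancel_r (U W W' : lmodType K) (I : Type) (g : I -> W -> W') :
  separated W' -> (forall i, lin_map (g i)) ->
  (forall w, (forall i, g i w = 0) -> w = 0) ->
  forall t t' : U ⊗ W,
    (forall i, tlift (fun u w => u ⊗ g i w) t = tlift (fun u w => u ⊗ g i w) t')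
  -> t = t'.
Proof.
move=> sW' lg ginj t t' tt'; apply: (can_inj (@tflipK _ _ _)).
apply: (tens_cancel_l sW' lg ginj) => i; have lgi := lg i.
rewrite !tlift_tflip; [|lin..].
have e (x : U ⊗ W) : tlift (fun u w => g i w ⊗ u) x =
    tflip (tlift (fun u w => u ⊗ g i w) x).
  by rewrite tlift_map; [apply: eq_tlift => u w; rewrite tflip_pure|lin].
by rewrite !e tt'.
Qed.

End Separation.

(** * Multipliers of a non-degenerate algebra *)

Section MultiplierCalculus.
Variables (K : fieldType) (A : algebra K).
Implicit Types (m n p : multiplier A) (a b c : A).

Lemma lactE m n a : lact (m · n) a = lact m (lact n a). Proof. by []. Qed.
Lemma ractE m n a : ract (m · n) a = ract n (ract m a). Proof. by []. Qed.

Lemma lactM m a b : lact m (a ∙ b) = lact m a ∙ b.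
Proof. by have [/= _ _ h _ _] := multiplierP m. Qed.

Lemma ractM m a b : ract m (a ∙ b) = a ∙ ract m b.
Proof. by have [/= _ _ _ h _] := multiplierP m. Qed.

Lemma ract_lact m a b : ract m a ∙ b = a ∙ lact m b.
Proof. by have [/= _ _ _ _ h] := multiplierP m. Qed.

Lemma mmulA m n p : m · (n · p) = (m · n) · p.
Proof. exact: multiplier_ext. Qed.

Lemma memb_lact m a : memb (lact m a) = m · memb a.
Proof.
by apply: multiplier_ext => b; [exact: esym (lactM m a b)
  |exact: esym (ract_lact m b a)].
Qed.

Lemma memb_ract m a : memb (ract m a) = memb a · m.
Proof.
by apply: multiplier_ext => b; [exact: ract_lact | exact: esym (ractM m b a)].
Qed.

Lemma membM a b : memb (a ∙ b) = memb a · memb b.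
Proof. exact: (memb_lact (memb a) b). Qed.

Lemma lact_lin k m n a : lact (k *: m + n) a = k *: lact m a + lact n a.
Proof. by []. Qed.

Lemma ract_lin k m n a : ract (k *: m + n) a = k *: ract m a + ract n a.
Proof. by []. Qed.

Lemma bilin_mmul : bilin_map (@mmul K A).
Proof.
apply: bilinI => x k y z; apply: multiplier_ext => a //.
- by rewrite ractE !ract_lin (lin_ract x).
- by rewrite lactE !lact_lin (lin_lact x).
Qed.

Lemma lin_memb : lin_map (@memb K A).
Proof.
move=> k x y; apply: multiplier_ext => a.
- exact: (bilin_amul A).1.
- exact: (bilin_amul A).2.
Qed.

Lemma bilin_lact : bilin_map (@lact K A).
Proof. by split=> [a k m n|m]; [exact: lact_lin|lin]. Qed.

Lemma bilin_ract : bilin_map (@ract K A).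
Proof. by split=> [a k m n|m]; [exact: ract_lin|lin]. Qed.

Hypothesis ndA : Defs.nondegenerate A.

Lemma memb_inj : injective (@memb K A).
Proof.
move=> a b ab; apply/eqP; rewrite -subr_eq0; apply/eqP; apply: ndA.1 => c.
rewrite (linearBE (f := fun x => x ∙ c)); last by lin.
by rewrite -[a ∙ c]/(lact (memb a) c) ab subrr.
Qed.

Lemma amul_injr a b : (forall c, a ∙ c = b ∙ c) -> a = b.
Proof.
move=> ab; apply/eqP; rewrite -subr_eq0; apply/eqP; apply: ndA.1 => c.
by rewrite (linearBE (f := fun x => x ∙ c)) ?ab ?subrr//; lin.
Qed.

Lemma amul_injl a b : (forall c, c ∙ a = c ∙ b) -> a = b.
Proof.
move=> ab; apply/eqP; rewrite -subr_eq0; apply/eqP; apply: ndA.2 => c.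
by rewrite (linearBE (f := fun x => c ∙ x)) ?ab ?subrr//; lin.
Qed.

Lemma munembK m : in_algebra m -> memb (munemb m) = m.
Proof. by move=> [a am]; apply: (@xgetPex _ 0 [set a | memb a = m]); exists a. Qed.

Lemma multiplier_ractP m n : ract m =1 ract n -> m = n.
Proof.
move=> mn; apply: multiplier_ext => // a; apply: amul_injl => b.
by rewrite -!ract_lact mn.
Qed.

(** Left and right multiplications by multipliers commute, although multipliers
need not: both sides become ract n (ract m b ∙ a) after multiplication by b on
the left. *)
Lemma lact_ractC m n a : lact m (ract n a) = ract n (lact m a).
Proof. by apply: amul_injl => b; rewrite -ract_lact -!ractM -ract_lact. Qed.

End MultiplierCalculus.

#[global] Hint Resolve bilin_mmul lin_memb bilin_lact bilin_ract : lin.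

Section Transport.
Variable K : fieldType.

Lemma mtransport_memb (A B : algebra K) (i : alg_iso A B) (a : A) :
  mtransport i (memb a) = memb (iso_fun i a).
Proof.
apply: multiplier_ext => c.
- by rewrite -[LHS]/(iso_fun i (a ∙ iso_inv i c)) iso_mul iso_invK.
- by rewrite -[LHS]/(iso_fun i (iso_inv i c ∙ a)) iso_mul iso_invK.
Qed.

Lemma mtransportM (A B : algebra K) (i : alg_iso A B) (m n : multiplier A) :
  mtransport i (m · n) = mtransport i m · mtransport i n.
Proof.
apply: multiplier_ext => c.
- by rewrite lactE -[RHS]/(iso_fun i (lact m (iso_inv i (iso_fun i _)))) iso_funK.
- by rewrite ractE -[RHS]/(iso_fun i (ract n (iso_inv i (iso_fun i _)))) iso_funK.
Qed.

End Transport.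

Section TensorNondegenerate.
Variables (K : fieldType) (A B : algebra K).
Hypotheses (ndA : Defs.nondegenerate A) (ndB : Defs.nondegenerate B).
Hypotheses (sA : separated A) (sB : separated B).

Lemma tens_cancel_mulr (t : A ⊗ B) :
  (forall a b, tlift (fun p q => (p ∙ a) ⊗ (q ∙ b)) t = 0) -> t = 0.
Proof.
move=> t0; apply: (tens_cancel_l (g := fun a p => p ∙ a)) => //.
- by move=> a; lin.
- exact: ndA.1.
move=> a; rewrite (linear0E (lin_tlift _)); last by lin.
apply: (tens_cancel_r (g := fun b q => q ∙ b)) => //.
- by move=> b; lin.
- exact: ndB.1.
move=> b; rewrite (linear0E (lin_tlift _)); last by lin.
rewrite tlift_tlift; last by lin.
by rewrite -(t0 a b); apply: eq_tlift => p q; rewrite tliftE//; lin.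
Qed.

Lemma tens_cancel_mull (t : A ⊗ B) :
  (forall a b, tlift (fun p q => (a ∙ p) ⊗ (b ∙ q)) t = 0) -> t = 0.
Proof.
move=> t0; apply: (tens_cancel_l (g := fun a p => a ∙ p)) => //.
- by move=> a; lin.
- exact: ndA.2.
move=> a; rewrite (linear0E (lin_tlift _)); last by lin.
apply: (tens_cancel_r (g := fun b q => b ∙ q)) => //.
- by move=> b; lin.
- exact: ndB.2.
move=> b; rewrite (linear0E (lin_tlift _)); last by lin.
rewrite tlift_tlift; last by lin.
by rewrite -(t0 a b); apply: eq_tlift => p q; rewrite tliftE//; lin.
Qed.

Lemma tmulE_pure_r (t : A ⊠ B) a b :
  t ∙ (a ⊗ b : A ⊠ B) = tlift (fun p q => (p ∙ a) ⊗ (q ∙ b)) t.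
Proof.
by apply: eq_tlift => p q; rewrite tliftE//; apply/bilin_mapE/tmul_bil_in.
Qed.

Lemma tmulE_pure_l (t : A ⊠ B) a b :
  (a ⊗ b : A ⊠ B) ∙ t = tlift (fun p q => (a ∙ p) ⊗ (b ∙ q)) t.
Proof.
rewrite -[LHS]/(tmul (a ⊗ b) t) /tmul tliftE//.
exact/bilin_mapE/tmul_bil_mid.
Qed.

(** Gives the injectivity of [memb] on A ⊗ A, hence the possibility of computing
with the elements T1 a b, ..., T4 a b inside the multiplier algebra. *)
Lemma nondegenerate_tens : Defs.nondegenerate (A ⊠ B).
Proof.
split=> t t0.
  by apply: tens_cancel_mulr => a b; rewrite -tmulE_pure_r t0.
by apply: tens_cancel_mull => a b; rewrite -tmulE_pure_l t0.
Qed.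

End TensorNondegenerate.

(** * Legs of A ⊗ A and the maps T1, T2, T3, T4 *)

Section Legs.
Variables (K : fieldType) (A : algebra K).
Local Notation ll := (@left_leg K A).
Local Notation rl := (@right_leg K A).

Lemma lact_ll_pure c a b : lact (ll c) (a ⊗ b) = (c ∙ a) ⊗ b.
Proof. by rewrite -[LHS]/(tmap _ _ _) tmapE//; lin. Qed.
Lemma lact_rl_pure c a b : lact (rl c) (a ⊗ b) = a ⊗ (c ∙ b).
Proof. by rewrite -[LHS]/(tmap _ _ _) tmapE//; lin. Qed.
Lemma ract_ll_pure c a b : ract (ll c) (a ⊗ b) = (a ∙ c) ⊗ b.
Proof. by rewrite -[LHS]/(tmap _ _ _) tmapE//; lin. Qed.
Lemma ract_rl_pure c a b : ract (rl c) (a ⊗ b) = a ⊗ (b ∙ c).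
Proof. by rewrite -[LHS]/(tmap _ _ _) tmapE//; lin. Qed.

Let pureE := (lact_ll_pure, lact_rl_pure, ract_ll_pure, ract_rl_pure).

Lemma left_right_leg a b : ll a · rl b = rl b · ll a.
Proof.
by apply: multiplier_ext; apply: tens_ext_lin => [||u v]; try lin;
  rewrite ?lactE ?ractE !pureE.
Qed.

Lemma right_legM a b : rl (a ∙ b) = rl a · rl b.
Proof.
by apply: multiplier_ext; apply: tens_ext_lin => [||u v]; try lin;
  rewrite ?lactE ?ractE !pureE ?amulA.
Qed.

Lemma memb_pure (a b : A) : memb (a ⊗ b : A ⊠ A) = ll a · rl b.
Proof.
apply: multiplier_ext; apply: tens_ext_lin => [||u v]; try lin.
- by rewrite lactE !pureE; exact: tmul_pure.
- by rewrite ractE !pureE; exact: tmul_pure.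
Qed.

Section Sums.
Variables (W : lmodType K) (F : A -> A -> W).
Hypothesis bF : bilin_map F.

Lemma tlift_lact_ll c t :
  tlift F (lact (ll c) t) = tlift (fun p q => F (c ∙ p) q) t.
Proof. by rewrite tlift_tmap//; lin. Qed.

Lemma tlift_lact_rl c t :
  tlift F (lact (rl c) t) = tlift (fun p q => F p (c ∙ q)) t.
Proof. by rewrite tlift_tmap//; lin. Qed.

Lemma tlift_ract_ll c t :
  tlift F (ract (ll c) t) = tlift (fun p q => F (p ∙ c) q) t.
Proof. by rewrite tlift_tmap//; lin. Qed.

Lemma tlift_ract_rl c t :
  tlift F (ract (rl c) t) = tlift (fun p q => F p (q ∙ c)) t.
Proof. by rewrite tlift_tmap//; lin. Qed.
End Sums.

Lemma tflip_ract_rl c (t : A ⊗ A) : tflip (ract (rl c) t) = ract (ll c) (tflip t).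
Proof.
move: t; apply: (tens_ext_lin (f := fun t => tflip (ract (rl c) t))
  (g := fun t => ract (ll c) (tflip t))) => [||p q]; [lin|lin|].
by rewrite ract_rl_pure !tflip_pure ract_ll_pure.
Qed.

Lemma mtransport_ll c : mtransport (flip_iso A A) (ll c) = rl c.
Proof.
apply: multiplier_ext; apply: tens_ext_lin => [||p q]; try lin.
- by rewrite -[LHS]/(tflip (lact (ll c) (tflip _))) tflip_pure lact_ll_pure
    tflip_pure lact_rl_pure.
- by rewrite -[LHS]/(tflip (ract (ll c) (tflip _))) tflip_pure ract_ll_pure
    tflip_pure ract_rl_pure.
Qed.

Lemma mtransport_rl c : mtransport (flip_iso A A) (rl c) = ll c.
Proof.
apply: multiplier_ext; apply: tens_ext_lin => [||p q]; try lin.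
- by rewrite -[LHS]/(tflip (lact (rl c) (tflip _))) tflip_pure lact_rl_pure
    tflip_pure lact_ll_pure.
- by rewrite -[LHS]/(tflip (ract (rl c) (tflip _))) tflip_pure ract_rl_pure
    tflip_pure ract_ll_pure.
Qed.

Lemma lin_left_leg : lin_map ll.
Proof.
move=> k x y; apply: multiplier_ext;
  rewrite ?lact_lin ?ract_lin; apply: tens_ext_lin => [||u v]; try lin.
- by rewrite lact_lin !lact_ll_pure; apply: (_ : lin_map (fun x => (x ∙ u) ⊗ v)); lin.
- by rewrite ract_lin !ract_ll_pure; apply: (_ : lin_map (fun x => (u ∙ x) ⊗ v)); lin.
Qed.

Lemma lin_right_leg : lin_map rl.
Proof.
move=> k x y; apply: multiplier_ext;
  rewrite ?lact_lin ?ract_lin; apply: tens_ext_lin => [||u v]; try lin.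
- by rewrite lact_lin !lact_rl_pure; apply: (_ : lin_map (fun x => u ⊗ (x ∙ v))); lin.
- by rewrite ract_lin !ract_rl_pure; apply: (_ : lin_map (fun x => u ⊗ (v ∙ x))); lin.
Qed.

End Legs.
#[global] Hint Resolve lin_left_leg lin_right_leg : lin.

Section LegCancel.
Variables (K : fieldType) (A : algebra K).
Hypotheses (ndA : Defs.nondegenerate A) (sA : separated A).

Lemma lact_ll_inj (W : lmodType K) (t t' : A ⊗ W) :
  (forall c, tlift (fun p q => (c ∙ p) ⊗ q) t = tlift (fun p q => (c ∙ p) ⊗ q) t')
  -> t = t'.
Proof.
by apply: (tens_cancel_l (g := fun c p => c ∙ p)) => // [c|]; [lin|exact: ndA.2].
Qed.

Lemma ract_ll_inj (W : lmodType K) (t t' : A ⊗ W) :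
  (forall c, tlift (fun p q => (p ∙ c) ⊗ q) t = tlift (fun p q => (p ∙ c) ⊗ q) t')
  -> t = t'.
Proof.
by apply: (tens_cancel_l (g := fun c p => p ∙ c)) => // [c|]; [lin|exact: ndA.1].
Qed.

Lemma lact_rl_inj (V : lmodType K) (t t' : V ⊗ A) :
  (forall c, tlift (fun p q => p ⊗ (c ∙ q)) t = tlift (fun p q => p ⊗ (c ∙ q)) t')
  -> t = t'.
Proof.
by apply: (tens_cancel_r (g := fun c p => c ∙ p)) => // [c|]; [lin|exact: ndA.2].
Qed.

Lemma ract_rl_inj (V : lmodType K) (t t' : V ⊗ A) :
  (forall c, tlift (fun p q => p ⊗ (q ∙ c)) t = tlift (fun p q => p ⊗ (q ∙ c)) t')
  -> t = t'.
Proof.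
by apply: (tens_cancel_r (g := fun c p => p ∙ c)) => // [c|]; [lin|exact: ndA.1].
Qed.

Lemma lact_ll_injm (t t' : A ⊗ A) :
  (forall c, lact (left_leg c) t = lact (left_leg c) t') -> t = t'.
Proof. by move=> tt'; apply: lact_ll_inj => c; exact: (tt' c). Qed.

Lemma ract_rl_injm (t t' : A ⊗ A) :
  (forall c, ract (right_leg c) t = ract (right_leg c) t') -> t = t'.
Proof. by move=> tt'; apply: ract_rl_inj => c; exact: (tt' c). Qed.

Lemma tens3_cancel_mulr (x x' : A ⊗ (A ⊗ A)) :
  (forall b d e,
     tlift (fun p t => (p ∙ b) ⊗ tlift (fun r s => (r ∙ d) ⊗ (s ∙ e)) t) x =
     tlift (fun p t => (p ∙ b) ⊗ tlift (fun r s => (r ∙ d) ⊗ (s ∙ e)) t) x') ->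
  x = x'.
Proof.
move=> xx'; apply: ract_ll_inj => b.
pose g (i : A * A) (t : A ⊗ A) := tlift (fun r s => (r ∙ i.1) ⊗ (s ∙ i.2)) t.
apply: (tens_cancel_r (g := g)); rewrite /g.
- exact: separated_tens.
- by move=> i; lin.
- by move=> t t0; apply: (tens_cancel_mulr ndA ndA sA sA) => a c; exact: (t0 (a, c)).
by move=> [d e] /=; rewrite !tlift_pures; [exact: xx'|lin..].
Qed.

Lemma tens3_cancel_mull (x x' : (A ⊗ A) ⊗ A) :
  (forall c z, tlift (fun t q => lact (left_leg c) t ⊗ (z ∙ q)) x =
               tlift (fun t q => lact (left_leg c) t ⊗ (z ∙ q)) x') -> x = x'.
Proof.
move=> xx'; apply: lact_rl_inj => z.
apply: (tens_cancel_l (g := fun (c : A) (t : A ⊗ A) => lact (left_leg c) t)).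
- exact: separated_tens.
- by move=> c; lin.
- move=> t t0; apply: lact_ll_injm => c.
  by rewrite t0 (linear0E (@lin_lact _ _ _)).
by move=> c; rewrite !tlift_pures; [exact: xx'|lin..].
Qed.

End LegCancel.

Section Coproduct.
Variables (K : fieldType) (A : algebra K) (Delta : A -> multiplier (A ⊠ A)).
Hypotheses (ndA : Defs.nondegenerate A) (sA : separated A).
Hypothesis copD : is_coproduct Delta.
Local Notation T1 := (T1 Delta).
Local Notation T2 := (T2 Delta).
Local Notation T3 := (T3 Delta).
Local Notation T4 := (T4 Delta).
Local Notation ll := (@left_leg K A).
Local Notation rl := (@right_leg K A).

Let nd2 : Defs.nondegenerate (A ⊠ A) := nondegenerate_tens ndA ndA sA sA.
Let m2_inj := memb_inj nd2.

Lemma lin_Delta : lin_map Delta.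
Proof. by case: copD => -[]. Qed.

Lemma DeltaM a b : Delta (a ∙ b) = Delta a · Delta b.
Proof. by case: copD => -[]. Qed.

Lemma memb_T1 a b : memb (T1 a b : A ⊠ A) = Delta a · rl b.
Proof. by apply: munembK; case: copD. Qed.

Lemma memb_T2 a b : memb (T2 a b : A ⊠ A) = ll a · Delta b.
Proof. by apply: munembK; case: copD. Qed.

Lemma bilin_T1 : bilin_map T1.
Proof.
have lD := lin_Delta.
have lm := @lin_memb K (A ⊠ A).
apply: bilinI => x k y z; apply: m2_inj; rewrite lm !memb_T1.
- by apply: (_ : lin_map (fun u => Delta u · rl x)); lin.
- by apply: (_ : lin_map (fun u => Delta x · rl u)); lin.
Qed.

Lemma bilin_T2 : bilin_map T2.
Proof.
have lD := lin_Delta.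
have lm := @lin_memb K (A ⊠ A).
apply: bilinI => x k y z; apply: m2_inj; rewrite lm !memb_T2.
- by apply: (_ : lin_map (fun u => ll u · Delta x)); lin.
- by apply: (_ : lin_map (fun u => ll x · Delta u)); lin.
Qed.

(** The relations between the four maps, here (c ⊗ 1)Δ(a)(1 ⊗ b), are
associativity in the multiplier algebra of A ⊗ A. *)
Lemma lact_ll_T1 a b c : lact (ll c) (T1 a b) = ract (rl b) (T2 c a).
Proof. by apply: m2_inj; rewrite memb_lact memb_ract memb_T1 memb_T2 mmulA. Qed.

Lemma T1_mull a a' b : T1 (a ∙ a') b = lact (Delta a) (T1 a' b).
Proof. by apply: m2_inj; rewrite memb_lact !memb_T1 DeltaM mmulA. Qed.

Lemma T2_mulr a b b' : T2 a (b ∙ b') = ract (Delta b') (T2 a b).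
Proof. by apply: m2_inj; rewrite memb_ract !memb_T2 DeltaM mmulA. Qed.

Lemma lact_ll_Delta c a t : lact (ll c) (lact (Delta a) t) = (T2 c a : A ⊠ A) ∙ t.
Proof. by rewrite -lactE -memb_T2. Qed.

Lemma lact_Delta_rl b a t : lact (Delta a) (lact (rl b) t) = (T1 a b : A ⊠ A) ∙ t.
Proof. by rewrite -lactE -memb_T1. Qed.

Lemma ract_rl_Delta c a t : ract (rl c) (ract (Delta a) t) = (t : A ⊠ A) ∙ T1 a c.
Proof. by rewrite -ractE -memb_T1. Qed.

Lemma ract_Delta_pure x a c : ract (Delta x) (a ⊗ c) = lact (rl c) (T2 a x).
Proof.
apply: m2_inj.
by rewrite memb_ract memb_lact memb_T2 memb_pure mmulA left_right_leg.
Qed.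

(** The coassociativity axiom, tested on a trilinear map: both sides are
Σ F(ca₍₁₎, a₍₂₎, a₍₃₎b). *)
Lemma coassoc (W : lmodType K) (F : A -> A -> A -> W) a b c :
  trilin_map F ->
  tlift (fun p q => tlift (fun r s => F r s q) (T2 c p)) (T1 a b) =
  tlift (fun r p => tlift (fun s q => F r s q) (T1 p b)) (T2 c a).
Proof.
move=> [F1 F2 F3]; have bT1 := bilin_T1; have bT2 := bilin_T2.
pose G := tlift (fun r t => tlift (F r) t) : A ⊗ (A ⊗ A) -> W.
have bG : bilin_map (fun r t => tlift (F r) t) by lin.
have lG : lin_map G by rewrite /G; lin.
have la : lin_map (@tassoc K A A A) by exact: tassoc_linear.
have GE x q : G (tassoc (x ⊗ q)) = tlift (fun r s => F r s q) x.
  move: x; apply: (tens_ext_lin (f := fun x => G (tassoc (x ⊗ q)))) => [||r s].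
  - by lin.
  - by lin.
  - by rewrite tassoc_pure /G !tliftE//; lin.
have [_ _ _ /(_ a b c)/(congr1 G)] := copD.
rewrite (tlift_map (g := fun x => G (tassoc x))); last by lin.
rewrite (tlift_map _ _ lG).
under eq_tlift do rewrite GE.
move=> ->; by apply: eq_tlift => r p; rewrite /G tliftE//; lin.
Qed.

Section Regular.
Hypothesis regD : regular_coproduct Delta.

Lemma memb_T3 a b : memb (T3 a b : A ⊠ A) = Delta a · ll b.
Proof. by apply: munembK; case: regD. Qed.

Lemma memb_T4 a b : memb (T4 a b : A ⊠ A) = rl a · Delta b.
Proof. by apply: munembK; case: regD. Qed.

Lemma bilin_T3 : bilin_map T3.
Proof.
have lD := lin_Delta.
have lm := @lin_memb K (A ⊠ A).
apply: bilinI => x k y z; apply: m2_inj; rewrite lm !memb_T3.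
- by apply: (_ : lin_map (fun u => Delta u · ll x)); lin.
- by apply: (_ : lin_map (fun u => Delta x · ll u)); lin.
Qed.

Lemma bilin_T4 : bilin_map T4.
Proof.
have lD := lin_Delta.
have lm := @lin_memb K (A ⊠ A).
apply: bilinI => x k y z; apply: m2_inj; rewrite lm !memb_T4.
- by apply: (_ : lin_map (fun u => rl u · Delta x)); lin.
- by apply: (_ : lin_map (fun u => rl x · Delta u)); lin.
Qed.

Lemma lact_ll_T4 a b c : lact (ll c) (T4 b a) = lact (rl b) (T2 c a).
Proof.
by apply: m2_inj; rewrite !memb_lact memb_T4 memb_T2 !mmulA left_right_leg.
Qed.

Lemma lact_rl_T1 a b c : lact (rl c) (T1 a b) = ract (rl b) (T4 c a).
Proof. by apply: m2_inj; rewrite memb_lact memb_ract memb_T1 memb_T4 mmulA. Qed.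

Lemma lact_ll_T3 a b c : lact (ll c) (T3 a b) = ract (ll b) (T2 c a).
Proof. by apply: m2_inj; rewrite memb_lact memb_ract memb_T3 memb_T2 mmulA. Qed.

Lemma lact_rl_T3 a b c : lact (rl c) (T3 a b) = ract (ll b) (T4 c a).
Proof. by apply: m2_inj; rewrite memb_lact memb_ract memb_T3 memb_T4 mmulA. Qed.

Lemma ract_ll_T1 a b c : ract (ll c) (T1 a b) = ract (rl b) (T3 a c).
Proof.
by apply: m2_inj; rewrite !memb_ract memb_T1 memb_T3 -!mmulA left_right_leg.
Qed.

Lemma T4_mull a b c : T4 (a ∙ b) c = lact (rl a) (T4 b c).
Proof.
apply: m2_inj.
by rewrite memb_lact !memb_T4 right_legM mmulA.
Qed.

(** The same with both outer legs covered from the left: both sides are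
Σ F(ca₍₁₎, a₍₂₎, ba₍₃₎). It follows from [coassoc] because, after multiplying
the third leg by y on the right, (1 ⊗ b)Δ(a)(1 ⊗ y) may be read through T1 as
well as through T4. *)
Lemma coassoc_left (W : lmodType K) (F : A -> A -> A -> W) a b c :
  trilin_map F ->
  tlift (fun p q => tlift (fun r s => F r s q) (T2 c p)) (T4 b a) =
  tlift (fun r p => tlift (fun s q => F r s q) (T4 b p)) (T2 c a).
Proof.
move=> [F1 F2 F3].
have bT1 := bilin_T1; have bT2 := bilin_T2; have bT4 := bilin_T4.
pose G := tlift (fun t q => tlift (fun r s => F r s q) t) : (A ⊗ A) ⊗ A -> W.
have bG : bilin_map (fun t q => tlift (fun r s => F r s q) t) by lin.
have -> : tlift (fun p q => tlift (fun r s => F r s q) (T2 c p)) (T4 b a) =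
    G (tlift (fun p q => T2 c p ⊗ q) (T4 b a)).
  by rewrite /G tlift_tlift//; apply: eq_tlift => p q; rewrite tliftE//; lin.
have -> : tlift (fun r p => tlift (fun s q => F r s q) (T4 b p)) (T2 c a) =
    G (tlift (fun r p => tlift (fun s q => (r ⊗ s) ⊗ q) (T4 b p)) (T2 c a)).
  rewrite /G tlift_tlift//; apply: eq_tlift => r p.
  by rewrite tlift_tlift//; apply: eq_tlift => s q; rewrite !tliftE//; lin.
congr G; apply: (ract_rl_inj ndA sA) => y.
pose F' (r s q : A) := (r ⊗ s) ⊗ q.
transitivity (tlift (fun p q => tlift (fun r s => F' r s (b ∙ q)) (T2 c p))
  (T1 a y)).
  rewrite tlift_pures; last by lin.
  rewrite -(tlift_ract_rl (F := fun p q => T2 c p ⊗ q)); last by lin.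
  rewrite -lact_rl_T1 tlift_lact_rl; last by lin.
  apply: eq_tlift => p q; rewrite /F'.
  by rewrite -(tlift_map (g := fun t => t ⊗ (b ∙ q)) (fun r s => r ⊗ s))
    ?tlift_tpure//; lin.
rewrite (coassoc (F := fun r s q => F' r s (b ∙ q))); last by rewrite /F'; lin.
rewrite tlift_tlift; last by lin.
apply: eq_tlift => r p.
rewrite tlift_pures; last by lin.
rewrite -(tlift_ract_rl (F := F' r)); last by rewrite /F'; lin.
by rewrite -lact_rl_T1 tlift_lact_rl//; rewrite /F'; lin.
Qed.
End Regular.
End Coproduct.

Section Coopposite.
Variables (K : fieldType) (A : algebra K) (Delta : A -> multiplier (A ⊠ A)).
Hypotheses (ndA : Defs.nondegenerate A) (sA : separated A).
Hypothesis regD : regular_coproduct Delta.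
Hypothesis copC : is_coproduct (Delta_cop Delta).
Local Notation T3 := (T3 Delta).
Local Notation T4 := (T4 Delta).

Let m2_inj := memb_inj (nondegenerate_tens ndA ndA sA sA).

Lemma T1_cop a b :
  Defs.T1 (Delta_cop Delta) a b = tflip (T3 a b).
Proof.
apply: m2_inj; rewrite (memb_T1 copC).
rewrite -[tflip (T3 a b)]/(iso_fun (flip_iso A A) (T3 a b)) -mtransport_memb.
by rewrite (memb_T3 regD) mtransportM mtransport_ll.
Qed.

Lemma T2_cop a b :
  Defs.T2 (Delta_cop Delta) a b = tflip (T4 a b).
Proof.
apply: m2_inj; rewrite (memb_T2 copC).
rewrite -[tflip (T4 a b)]/(iso_fun (flip_iso A A) (T4 a b)) -mtransport_memb.
by rewrite (memb_T4 regD) mtransportM mtransport_rl.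
Qed.

End Coopposite.

(** * The canonical idempotent, the counit and the antipode *)

Section CanonicalIdempotent.
Variables (K : fieldType) (A : algebra K) (Delta : A -> multiplier (A ⊠ A)).
Hypotheses (ndA : Defs.nondegenerate A) (sA : separated A).
Hypothesis copD : is_coproduct Delta.
Variable E : multiplier (A ⊠ A).
Hypothesis canE : canonical_idempotent Delta E.
Local Notation T1 := (T1 Delta).
Local Notation T2 := (T2 Delta).

Let nd2 : Defs.nondegenerate (A ⊠ A) := nondegenerate_tens ndA ndA sA sA.
Let bT1 := bilin_T1 ndA sA copD.
Let bT2 := bilin_T2 ndA sA copD.

Lemma lactEE t : lact E (lact E t) = lact E t.
Proof. by have [EE _ _ _] := canE; rewrite -lactE EE. Qed.

Lemma lactE_T1 a b : lact E (T1 a b) = T1 a b.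
Proof.
have [_ [rT1 _] _ _] := canE.
have : range (tlift T1) (T1 a b) by exists (a ⊗ b) => //; rewrite tliftE.
by rewrite rT1 => -[t _ <-]; rewrite lactEE.
Qed.

Lemma ractE_T2 a b : ract E (T2 a b) = T2 a b.
Proof.
have [EE [_ rT2] _ _] := canE.
have : range (tlift T2) (T2 a b) by exists (a ⊗ b) => //; rewrite tliftE.
by rewrite rT2 => -[t _ <-]; rewrite -ractE EE.
Qed.

Lemma lact_Delta_E a t : lact (Delta a) (lact E t) = lact (Delta a) t.
Proof.
apply: (lact_ll_injm ndA sA) => c.
rewrite !(lact_ll_Delta copD).
by rewrite -(ract_lact E (T2 c a : A ⊠ A)) ractE_T2.
Qed.

Lemma E_Delta a : E · Delta a = Delta a.
Proof.
apply: (multiplier_ractP nd2) => t; rewrite ractE.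
apply: (ract_rl_injm ndA sA) => c.
by rewrite !(ract_rl_Delta copD) ract_lact lactE_T1.
Qed.

End CanonicalIdempotent.

Section Counit.
Variables (K : fieldType) (A : algebra K) (Delta : A -> multiplier (A ⊠ A)).
Hypotheses (ndA : Defs.nondegenerate A) (sA : separated A).
Hypothesis copD : is_coproduct Delta.
Hypothesis regD : regular_coproduct Delta.
Variable eps : A -> K^o.
Hypothesis epsP : is_counit Delta eps.
Local Notation T4 := (T4 Delta).

Lemma lin_counit : lin_map eps.
Proof. by case: epsP. Qed.

(** (ε ⊗ ι)((1 ⊗ b)Δ(a)) = ba, from the defining property of ε after covering the
second leg by c on the right. *)
Lemma counit_T4 a b : tlift (fun p q => (eps p : K) *: q) (T4 b a) = b ∙ a.
Proof.
have le := lin_counit.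
apply: (amul_injr ndA) => c.
have -> : tlift (fun p q => (eps p : K) *: q) (T4 b a) ∙ c =
    tlift (fun p q => (eps p : K) *: q) (ract (right_leg c) (T4 b a)).
  rewrite tlift_ract_rl; last by lin.
  rewrite (tlift_map (g := fun x => x ∙ c)); last by lin.
  by apply: eq_tlift => p q; rewrite (linearZE (f := fun x => x ∙ c))//; lin.
rewrite -(lact_rl_T1 ndA sA copD regD) tlift_lact_rl; last by lin.
under eq_tlift do rewrite -(linearZE (lin_bil_r b (bilin_amul A))).
rewrite -tlift_map; last by lin.
by case: epsP => _ -> _; rewrite amulA.
Qed.

End Counit.

Section Antipode.
Variables (K : fieldType) (A : algebra K) (Delta : A -> multiplier (A ⊠ A)).
Hypotheses (ndA : Defs.nondegenerate A) (sA : separated A).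
Hypothesis copD : is_coproduct Delta.
Hypothesis regD : regular_coproduct Delta.
Variable eps : A -> K^o.
Hypothesis epsP : is_counit Delta eps.
Variable E : multiplier (A ⊠ A).
Hypothesis canE : canonical_idempotent Delta E.
Variables S Sinv : A -> A.
Hypothesis antS : is_antipode Delta E (fun a => memb (S a)).
Hypotheses (SK : cancel S Sinv) (SinvK : cancel Sinv S).
Local Notation T1 := (T1 Delta).
Local Notation T2 := (T2 Delta).
Local Notation T4 := (T4 Delta).
Local Notation ll := (@left_leg K A).

Let bT1 := bilin_T1 ndA sA copD.
Let bT2 := bilin_T2 ndA sA copD.
Let bT3 := bilin_T3 ndA sA copD regD.
Let bT4 := bilin_T4 ndA sA copD regD.
Let leps := lin_counit epsP.
Let nd2 : Defs.nondegenerate (A ⊠ A) := nondegenerate_tens ndA ndA sA sA.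

Lemma lin_antipode : lin_map S.
Proof.
have [lS _ _] := antS => k x y; apply: (memb_inj ndA).
by rewrite lS (@lin_memb K A).
Qed.
Let lS := lin_antipode.

Lemma antipodeM a b : S (a ∙ b) = S b ∙ S a.
Proof. by have [_ SM _] := antS; apply: (memb_inj ndA); rewrite SM membM. Qed.

Lemma antipode_invM a b : Sinv (a ∙ b) = Sinv b ∙ Sinv a.
Proof. by apply: (can_inj SK); rewrite antipodeM !SinvK. Qed.

Lemma lin_antipode_inv : lin_map Sinv.
Proof. by move=> k x y; apply: (can_inj SK); rewrite lS !SinvK. Qed.
Let lSi := lin_antipode_inv.

(** E(c ⊗ 1) = Σ c₍₁₎ ⊗ c₍₂₎S(c₍₃₎), which is T₁R₁ = E. Writing the second factor as
S(b) makes R₁ explicit: R₁(c ⊗ S(b)) = (ι ⊗ S)((1 ⊗ b)Δ(c)), since S is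
anti-multiplicative. *)
Lemma lactE_antipode c b :
  lact E (c ⊗ S b) = tlift (fun p q => T1 p (S q)) (T4 b c).
Proof.
have [_ _ [G1 [G2 [R1 [R2 [_ _ [R1E _] [T1R1 _] _]]]]]] := antS.
have R1S : R1 (c ⊗ S b) = tlift (fun p q => p ⊗ S q) (T4 b c).
  apply: (lact_ll_injm ndA sA) => x; rewrite R1E.
  rewrite (tlift_map _ _ (lin_lact _)).
  under [RHS]eq_tlift do rewrite lact_ll_pure.
  rewrite -(tlift_lact_ll (F := fun p q => p ⊗ S q)); last by lin.
  rewrite (lact_ll_T4 ndA sA copD regD) tlift_lact_rl; last by lin.
  by apply: eq_tlift => p q; rewrite antipodeM.
by rewrite -T1R1 R1S tlift_pures.
Qed.

(** (Δ ⊗ ι)(E(c ⊗ d)) = (1 ⊗ E)(Δ(c) ⊗ d), with the first leg covered by x. By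
[lactE_antipode] both sides are Σ xc₍₁₎ ⊗ c₍₂₎ ⊗ c₍₃₎S(c₍₄₎)d. *)
Lemma T2_lactE (W : lmodType K) (F : A -> A -> A -> W) x c d :
  trilin_map F ->
  tlift (fun p q => tlift (fun r s => F r s q) (T2 x p)) (lact E (c ⊗ d)) =
  tlift (fun r v => tlift (fun s q => F r s q) (lact E (v ⊗ d))) (T2 x c).
Proof.
move=> F3; rewrite -(SinvK d) lactE_antipode; have [? ? ?] := F3.
rewrite tlift_tlift; last by lin.
under eq_tlift do rewrite (coassoc ndA sA copD)//.
rewrite (coassoc_left ndA sA copD regD
  (F := fun r v q => tlift (fun s q' => F r s q') (T1 v (S q)))); last by lin.
by apply: eq_tlift => r v; rewrite lactE_antipode tlift_tlift//; lin.
Qed.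

(** The counital map: Σ v₍₁₎S(v₍₂₎)d, by [counital_target]. *)
Definition counital (v d : A) : A :=
  tlift (fun p q => (eps p : K) *: q) (lact E (v ⊗ d)).

Lemma bilin_counital : bilin_map counital.
Proof. by rewrite /counital; lin. Qed.

(** E(c ⊗ d) = Σ c₍₁₎ ⊗ ε_t(c₍₂₎)d, where ε_t(v)d = [counital v d]: apply ε to the
middle leg in [T2_lactE]. *)
Lemma lact_ll_E x c d :
  lact (ll x) (lact E (c ⊗ d)) = tlift (fun r v => r ⊗ counital v d) (T2 x c).
Proof.
rewrite -[LHS]tlift_tpure tlift_lact_ll; last by lin.
transitivity (tlift (fun p q =>
    tlift (fun r s => ((eps s : K) *: r) ⊗ q) (T2 x p)) (lact E (c ⊗ d))).
  apply: eq_tlift => p q; have [_ _ e2] := epsP.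
  by rewrite -e2 (tlift_map (g := fun y => y ⊗ q))//; lin.
rewrite T2_lactE; last by lin.
apply: eq_tlift => r v; rewrite /counital.
rewrite (tlift_map (g := fun y => r ⊗ y)); last by lin.
apply: eq_tlift => s q.
by rewrite (linearZE (f := fun y => y ⊗ q)) ?(linearZE (f := fun y => r ⊗ y))//; lin.
Qed.

(** Σ zv₍₁₎S(v₍₂₎), that is zε_t(v). *)
Definition target_map (z v : A) : A := tlift (fun p q => p ∙ S q) (T2 z v).

Lemma counital_target z v d : z ∙ counital v d = target_map z v ∙ d.
Proof.
rewrite -(SinvK d) /counital lactE_antipode; set b := Sinv d.
rewrite tlift_tlift; last by lin.
under eq_tlift do (have [_ -> _] := epsP).
rewrite (tlift_map (g := fun y => z ∙ y)); last by lin.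
under eq_tlift do rewrite amulA.
rewrite -(tlift_lact_ll (F := fun p q => p ∙ S q)); last by lin.
rewrite (lact_ll_T4 ndA sA copD regD) tlift_lact_rl; last by lin.
rewrite /target_map (tlift_map (g := fun y => y ∙ S b)); last by lin.
by apply: eq_tlift => p q; rewrite antipodeM amulA.
Qed.

(** (x ⊗ z)E(c ⊗ 1) = Σ xc₍₁₎ ⊗ zε_t(c₍₂₎), the form of [lact_ll_E] that is covered
from the left. *)
Lemma ractE_target x z c :
  tlift (fun p q => (p ∙ c) ⊗ q) (ract E (x ⊗ z)) =
  tlift (fun r v => r ⊗ target_map z v) (T2 x c).
Proof.
apply: (ract_rl_inj ndA sA) => d.
rewrite !tlift_pures; [|lin..].
rewrite -(tmulE_pure_r (ract E (x ⊗ z)) c d) ract_lact tmulE_pure_l.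
rewrite -(tlift_lact_ll (F := fun p q => p ⊗ (z ∙ q))); last by lin.
have bc := bilin_counital; rewrite lact_ll_E tlift_pures; last by lin.
by apply: eq_tlift => r v; rewrite counital_target.
Qed.

(** A right multiplier ρ that vanishes on all zε_t(v) is zero. By [ractE_target],
ι ⊗ ρ kills (A ⊗ A)E, hence all (x ⊗ 1)Δ(z), hence (1 ⊗ b)Δ(z); applying ε to
the first leg of the latter gives ρ(bz) = bρ(z) = 0. *)
Lemma right_multiplier_eq0 (rho : A -> A) :
  lin_map rho -> (forall a b, rho (a ∙ b) = a ∙ rho b) ->
  (forall z v, rho (target_map z v) = 0) -> forall a, rho a = 0.
Proof.
move=> lr rM r0.
have rE t : tlift (fun p q => p ⊗ rho q) (ract E t) = 0.
  apply: (tens_ext_lin (f := fun t => tlift _ (ract E t)) (g := fun=> 0)) => [||x z].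
  - by lin.
  - by move=> k u v; rewrite scaler0 addr0.
  apply: (ract_ll_inj ndA sA) => c; rewrite tlift_pures; last by lin.
  rewrite -(tlift_pures (F := fun p q => p ⊗ rho q) (fun p q => p ∙ c)
    (fun p q => q)); last by lin.
  rewrite ractE_target tlift_pures; last by lin.
  rewrite (linear0E (lin_tlift _)); last by lin.
  rewrite -[RHS](tlift0 _ (T2 x c)); apply: eq_tlift => r v.
  by rewrite r0 (linear0E (lin_bil_r _ (bilin_tpure _ _))).
move=> z; apply: (ndA.2) => b; rewrite -rM.
rewrite -(counit_T4 ndA sA copD regD epsP) (tlift_map _ _ lr).
under eq_tlift do rewrite (linearZE lr).
have -> : tlift (fun u v => eps u *: rho v) (T4 b z) =
    tlift (fun u v => (eps u : K) *: v) (tlift (fun u v => u ⊗ rho v) (T4 b z)).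
  by rewrite tlift_pures//; lin.
suff -> : tlift (fun u v => u ⊗ rho v) (T4 b z) = 0.
  by apply: (linear0E (lin_tlift _)); lin.
apply: (lact_ll_inj ndA sA) => x.
rewrite (linear0E (lin_tlift _)); last by lin.
rewrite tlift_pures; last by lin.
rewrite -(tlift_lact_ll (F := fun p q => p ⊗ rho q)); last by lin.
rewrite (lact_ll_T4 ndA sA copD regD) tlift_lact_rl; last by lin.
under eq_tlift do rewrite rM.
rewrite -(tlift_pures (F := fun p q => p ⊗ (b ∙ q)) (fun p q => p)
    (fun p q => rho q)); last by lin.
rewrite -(ractE_T2 ndA sA copD canE) rE.
by apply: (linear0E (lin_tlift _)); lin.
Qed.

(** S(E₍₁₎)E₍₂₎ = 1, equivalently Σ S(c₍₁₎)c₍₂₎S(c₍₃₎) = S(c). The axioms T₁R₁ = E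
and E² = E only give Σ c₍₁₎Q(c₍₂₎, d) = ε_t(c)d for Q(c, d) = S(E₍₁₎c)E₍₂₎d. The
other input is that S is a bijective anti-homomorphism: it makes
ρ(e) = eS(E₍₁₎)E₍₂₎d - ed a right multiplier, which vanishes on all zε_t(v). *)
Lemma antipode_lactE c d :
  tlift (fun p q => S p ∙ q) (lact E (c ⊗ d)) = S c ∙ d.
Proof.
pose Q (c d : A) := tlift (fun p q => S p ∙ q) (lact E (c ⊗ d)).
have bQ : bilin_map Q by rewrite /Q; lin.
have bc := bilin_counital.
have counitalE t : tlift counital t =
    tlift (fun p q => (eps p : K) *: q) (lact E t).
  apply: (tens_ext_lin (f := tlift counital)
    (g := fun t => tlift (fun p q => (eps p : K) *: q) (lact E t))) => [||v w].
  - by lin.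
  - by lin.
  by rewrite tliftE.
(* Both sides are yε_t(E₍₁₎v)E₍₂₎d, and E is idempotent. *)
have QT y v : tlift (fun r q => r ∙ Q q d) (T2 y v) = y ∙ counital v d.
  under eq_tlift => r q.
    rewrite /Q (tlift_map (g := fun x => r ∙ x)); last by lin.
    over.
  rewrite -(T2_lactE (F := fun r s q => r ∙ (S s ∙ q))); last by lin.
  transitivity (tlift (fun p q => y ∙ counital p q) (lact E (v ⊗ d))).
    apply: eq_tlift => p q; rewrite counital_target /target_map.
    rewrite (tlift_map (g := fun x => x ∙ q)); last by lin.
    by apply: eq_tlift => r s; rewrite amulA.
  rewrite -(tlift_map (g := fun x => y ∙ x)); last by lin.
  by rewrite counitalE (lactEE canE).
have QM u v : Q (u ∙ v) d = S v ∙ Q u d.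
  rewrite /Q -(ract_ll_pure v u d) (lact_ractC nd2) tlift_ract_ll; last by lin.
  rewrite (tlift_map (g := fun x => S v ∙ x)); last by lin.
  by apply: eq_tlift => p q; rewrite antipodeM amulA.
pose rho e := Q (Sinv e) d - e ∙ d.
have lr : lin_map rho by rewrite /rho; lin.
apply/eqP; rewrite -subr_eq0; apply/eqP.
have -> : tlift (fun p q => S p ∙ q) (lact E (c ⊗ d)) - S c ∙ d = rho (S c).
  by rewrite /rho SK.
apply: (right_multiplier_eq0 lr) => [a b|y v].
  rewrite /rho antipode_invM QM SinvK (linearBE (lin_bil_r a (bilin_amul A))).
  by rewrite amulA.
rewrite /target_map (tlift_map _ _ lr).
have rS q p : rho (p ∙ S q) = p ∙ Q q d - p ∙ (S q ∙ d).
  by rewrite /rho antipode_invM SK QM SinvK amulA.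
under eq_tlift do rewrite rS.
rewrite tliftB QT counital_target /target_map.
rewrite (tlift_map (g := fun x => x ∙ d)); last by lin.
by under eq_tlift do rewrite -amulA; rewrite subrr.
Qed.

End Antipode.

(** * Left integrals and the formula for aS(E₍₁₎)φ(E₍₂₎c) *)

Section Integrals.
Variables (K : fieldType) (A : algebra K) (Delta : A -> multiplier (A ⊠ A)).
Hypotheses (ndA : Defs.nondegenerate A) (sA : separated A).
Hypothesis copD : is_coproduct Delta.
Hypothesis regD : regular_coproduct Delta.
Variable eps : A -> K^o.
Hypothesis epsP : is_counit Delta eps.
Variable E : multiplier (A ⊠ A).
Hypothesis canE : canonical_idempotent Delta E.
Variables S Sinv : A -> A.
Hypothesis antS : is_antipode Delta E (fun a => memb (S a)).
Hypotheses (SK : cancel S Sinv) (SinvK : cancel Sinv S).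
Local Notation T1 := (T1 Delta).
Local Notation T2 := (T2 Delta).
Local Notation T3 := (T3 Delta).
Local Notation T4 := (T4 Delta).
Local Notation ll := (@left_leg K A).
Local Notation rl := (@right_leg K A).

Let bT1 := bilin_T1 ndA sA copD.
Let bT2 := bilin_T2 ndA sA copD.
Let bT3 := bilin_T3 ndA sA copD regD.
Let bT4 := bilin_T4 ndA sA copD regD.
Let lD := lin_Delta copD.
Let leps := lin_counit epsP.
Let nd2 : Defs.nondegenerate (A ⊠ A) := nondegenerate_tens ndA ndA sA sA.
Let lS := lin_antipode ndA antS.

(** E₍₁₎b ⊗ Δ(E₍₂₎c) = (E ⊗ 1)(b ⊗ Δ(c)): the axiom on (ι ⊗ Δ)E, evaluated on
elements of A ⊗ A ⊗ A and freed from the factors b' ⊗ d ⊗ e' on the right. *)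
Lemma lactE_T1r_tens b c e :
  tlift (fun p q => p ⊗ T1 q e) (lact E (b ⊗ c)) =
  tlift (fun u v => tlift (fun p r => p ⊗ (r ⊗ v)) (lact E (b ⊗ u))) (T1 c e).
Proof.
apply: (tens3_cancel_mulr ndA sA) => b' d e'.
have [_ _ [[_ _ XE _] _] _] := canE.
have hE t w : lact (id_tens_Delta Delta t) (b' ⊗ w) =
    tlift (fun p q => (p ∙ b') ⊗ lact (Delta q) w) t.
  rewrite /id_tens_Delta.
  rewrite (tlift_map (g := fun m : multiplier (A ⊠ (A ⊠ A)) =>
    lact m (b' ⊗ w))).
    by apply: eq_tlift => p q; apply: tmapE; lin.
  by move=> k x y.
have T1w x : lact (Delta x) (d ⊗ (e ∙ e')) =
    tlift (fun r s => (r ∙ d) ⊗ (s ∙ e')) (T1 x e).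
  by rewrite -lact_rl_pure (lact_Delta_rl copD) tmulE_pure_r.
have := congr1 (fun m : multiplier (A ⊠ (A ⊠ A)) =>
  lact m (b' ⊗ (d ⊗ (e ∙ e')))) (XE (b ⊗ c)).
rewrite !lactE !hE tliftE; last by lin.
rewrite (_ : lact (E23 E) _ = (b ∙ b') ⊗ lact (Delta c) (d ⊗ (e ∙ e'))); last first.
  by rewrite -[LHS]/(tmap _ _ _) tmapE -?lactE ?(E_Delta ndA sA copD canE)//; lin.
rewrite T1w (tlift_map (g := fun w => lact (E12 E) ((b ∙ b') ⊗ w))); last by lin.
under [RHS]eq_tlift do rewrite T1w.
rewrite tlift_pures; last by lin.
move=> <-; rewrite [RHS]tlift_tlift; last by lin.
apply: eq_tlift => u v; rewrite [RHS]tlift_pures; last by lin.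
under [RHS]eq_tlift => p r.
  rewrite tliftE; last by lin.
  over.
have la : lin_map (@tassoc K A A A) by exact: tassoc_linear.
rewrite -[lact (E12 E) _]/(tassoc (tmap (lact E) id (tassocV _))) tassocV_pure.
rewrite tmapE; [|lin..].
rewrite -(tmul_pure (A := A) (B := A)) -[tmul _ _]/((_ : A ⊠ A) ∙ _) lactM.
rewrite tmulE_pure_r (tlift_map (g := fun t => tassoc (t ⊗ (v ∙ e')))); last by lin.
by apply: eq_tlift => p r; rewrite tassoc_pure.
Qed.

Lemma T1_lactE (W : lmodType K) (F : A -> A -> A -> W) b c e :
  trilin_map F ->
  tlift (fun p q => tlift (F p) (T1 q e)) (lact E (b ⊗ c)) =
  tlift (fun u v => tlift (fun p r => F p r v) (lact E (b ⊗ u))) (T1 c e).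
Proof.
move=> [F1 F2 F3].
pose G : A ⊗ (A ⊗ A) -> W := tlift (fun p t => tlift (F p) t).
have := congr1 G (lactE_T1r_tens b c e); rewrite /G tlift_pures; last by lin.
move=> ->; rewrite tlift_tlift; last by lin.
apply: eq_tlift => u v; rewrite tlift_pures; last by lin.
by apply: eq_tlift => p r; rewrite tliftE//; lin.
Qed.

(** S(b)S(E₍₁₎)(E₍₂₎c)₍₁₎ ⊗ (E₍₂₎c)₍₂₎ = S(b)S(E₍₁₎)E₍₂₎c₍₁₎ ⊗ c₍₂₎ by [T1_lactE], and
S(E₍₁₎)E₍₂₎ = 1. *)
Lemma T2_antipode_lactE b c :
  tlift (fun p q => T2 (S p) q) (lact E (b ⊗ c)) = T2 (S b) c.
Proof.
apply: (ract_rl_injm ndA sA) => e.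
rewrite (tlift_map _ _ (@lin_ract _ _ _)).
under eq_tlift do rewrite -(lact_ll_T1 ndA sA copD).
transitivity (tlift (fun p q => tlift (fun r s => (S p ∙ r) ⊗ s) (T1 q e))
  (lact E (b ⊗ c))).
  apply: eq_tlift => p q.
  by rewrite -[LHS]tlift_tpure tlift_lact_ll//; lin.
rewrite T1_lactE; last by lin.
rewrite -(lact_ll_T1 ndA sA copD) -[RHS]tlift_tpure tlift_lact_ll; last by lin.
apply: eq_tlift => u v.
rewrite -(antipode_lactE ndA sA copD regD epsP canE antS SK SinvK b u).
by rewrite (tlift_map (g := fun x => x ⊗ v))//; lin.
Qed.

(** E commutes with y ⊗ 1 for y in A_t: in [lact_ll_E] the element y only meets
(x ⊗ 1)Δ(yc) = (xy ⊗ 1)Δ(c). *)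
Lemma lactE_target y c d : target_algebra Delta y ->
  lact E (lact y c ⊗ d) = tmap (lact y) id (lact E (c ⊗ d)).
Proof.
move=> yt; apply: (lact_ll_injm ndA sA) => x.
have lE := lact_ll_E ndA sA copD regD epsP antS SinvK.
rewrite lE yt -lE -[LHS]tlift_tpure tlift_lact_ll; last by lin.
rewrite -[RHS]tlift_tpure tlift_lact_ll; last by lin.
rewrite tlift_tmap; [|lin..].
by apply: eq_tlift => p q; rewrite ract_lact.
Qed.

(** For w = a ⊗ d this is Σ b₍₁₎a ⊗ b₍₂₎d ⊗ b₍₃₎. *)
Definition cop3 (b : A) (w : A ⊗ A) : (A ⊗ A) ⊗ A :=
  tlift (fun a d => tlift (fun p v => tlift (fun s q => (p ⊗ s) ⊗ q) (T3 v d))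
    (T3 b a)) w.

Lemma lin_cop3 b : lin_map (cop3 b).
Proof. by rewrite /cop3; lin. Qed.

(** Covering the first and third legs from the left turns the triple coproduct into
Σ (x ⊗ 1)Δ(f)w ⊗ q with Σ f ⊗ q = (1 ⊗ z)Δ(b), where w only meets values
of Δ. *)
Lemma lact_cop3 x z b w :
  tlift (fun t q => lact (ll x) t ⊗ (z ∙ q)) (cop3 b w) =
  tlift (fun f q => ((T2 x f : A ⊠ A) ∙ w) ⊗ q) (T4 z b).
Proof.
have lc := lin_cop3 b.
have l2 : lin_map (fun w : A ⊗ A =>
    tlift (fun f q => ((T2 x f : A ⊠ A) ∙ w) ⊗ q) (T4 z b)).
  apply: lin_tlift_body => f q.
  apply: (lin_comp (h := fun t : A ⊗ A => t ⊗ q)); [by lin|].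
  exact: (bilin_amul (A ⊠ A)).2.
move: w; apply: (tens_ext_lin (f := fun w => tlift _ (cop3 b w))) => //.
  by lin.
move=> a d; rewrite /cop3 tliftE; last by lin.
rewrite tlift_tlift; last by lin.
transitivity (tlift (fun p v => tlift (fun s q => ((x ∙ p) ⊗ s) ⊗ (z ∙ q)) (T3 v d))
    (T3 b a)).
  apply: eq_tlift => p v; rewrite tlift_pures; last by lin.
  by apply: eq_tlift => s q; rewrite lact_ll_pure.
pose G (r v : A) := tlift (fun s q => (r ⊗ s) ⊗ (z ∙ q)) (T3 v d).
have bG : bilin_map G by rewrite /G; lin.
rewrite -(tlift_lact_ll (F := G))// (lact_ll_T3 ndA sA copD regD) tlift_ract_ll//.
pose F (r s q : A) := ((r ∙ a) ⊗ (s ∙ d)) ⊗ q.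
transitivity (tlift (fun r v => tlift (fun s q => F r s q) (T4 z v)) (T2 x b)).
  apply: eq_tlift => r v; rewrite /G /F.
  rewrite -(tlift_lact_rl (F := fun s q => ((r ∙ a) ⊗ s) ⊗ q)); last by lin.
  by rewrite (lact_rl_T3 ndA sA regD) tlift_ract_ll//; lin.
rewrite -(coassoc_left ndA sA copD regD (F := F)); last by rewrite /F; lin.
apply: eq_tlift => f q; rewrite tmulE_pure_r.
by rewrite (tlift_map (g := fun t : A ⊗ A => t ⊗ q))//; lin.
Qed.

Lemma cop3_lactE b w : cop3 b (lact E w) = cop3 b w.
Proof.
apply: (tens3_cancel_mull ndA sA) => x z; rewrite !lact_cop3.
apply: eq_tlift => f q; congr (_ ⊗ _).
by rewrite -ract_lact (ractE_T2 ndA sA copD canE).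
Qed.

Lemma cop3_T1 b e g :
  cop3 b (T1 e g) = tlift (fun f q => T1 f g ⊗ q) (T3 b e).
Proof.
apply: (tens3_cancel_mull ndA sA) => x z; rewrite lact_cop3.
rewrite tlift_pures; last by lin.
rewrite -(tlift_lact_rl (F := fun f q => lact (ll x) (T1 f g) ⊗ q)); last by lin.
rewrite (lact_rl_T3 ndA sA regD) tlift_ract_ll; last by lin.
apply: eq_tlift => f q; congr (_ ⊗ _).
by rewrite (T1_mull ndA sA copD) (lact_ll_Delta copD).
Qed.

Hypothesis idA : idempotent_algebra A.
Hypothesis copW : weak_multiplier_hopf (Delta_cop Delta).

(** The elements Δ(c)(b ⊗ 1) span E(A ⊗ A). The flip of their span is the range of
the first canonical map of the coopposite algebra, hence a right ideal of the
form E'(A ⊗ A). It contains Δ(e)(a ⊗ g) for all e, a and g, and these elements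
span E(A² ⊗ A) = E(A ⊗ A). *)
Lemma lactE_range_T3 w : range (tlift T3) (lact E w).
Proof.
have [_ _ [copC _] _ [E' canE']] := copW.
have hR : is_subspace (range (tlift T3)) by apply: range_subspace; lin.
have key e a g : range (tlift T3) (ract (rl g) (T3 e a)).
  have [_ [rT1 _] _ _] := canE'.
  have : range (lact E') (tflip (ract (rl g) (T3 e a))).
    rewrite tflip_ract_rl -(T1_cop ndA sA regD copC).
    rewrite -(lactE_T1 ndA sA copC canE') -(lact_ractC nd2).
    by exists (ract (ll g) (Defs.T1 (Delta_cop Delta) e a)).
  rewrite -rT1 => -[u _ uE]; exists u => //.
  rewrite -[RHS]tflipK -uE -[LHS]tflipK (tlift_map _ _ (@lin_tflip _ _ _)).
  by congr tflip; apply: eq_tlift => p q; rewrite (T1_cop ndA sA regD copC).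
rewrite -[w]tlift_tpure (tlift_map _ _ (@lin_lact _ _ _)).
apply: subspace_tlift => // a b.
pose P := [set a | range (tlift T3) (lact E (a ⊗ b))].
have hP : is_subspace P.
  have l1 : lin_map (fun a => lact E (a ⊗ b)) by lin.
  split; rewrite /P /=; first by rewrite (linear0E l1); exact: hR.1.
  by move=> k u v Pu Pv; rewrite l1; exact: hR.2.
have : lspan [set x : A | exists a b, x = a ∙ b] a by rewrite idA.
apply: (lspan_min hP) => _ [x [y ->]]; rewrite /P /=.
rewrite -ract_ll_pure (lact_ractC nd2).
have [_ [rT1 _] _ _] := canE.
have [u _ <-] : range (tlift T1) (lact E (x ⊗ b)) by rewrite rT1; exists (x ⊗ b).
rewrite (tlift_map _ _ (@lin_ract _ _ _)); apply: (subspace_tlift u hR) => e g.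
by rewrite (ract_ll_T1 ndA sA copD regD).
Qed.

Variable phi : A -> K^o.
Hypothesis phiL : left_integral Delta phi.

Let lphi : lin_map phi.
Proof. by case: phiL. Qed.

(** Σ b₍₁₎a φ(b₍₂₎), that is ya with y = (ι ⊗ φ)Δ(b) in A_t. *)
Definition slice (b a : A) : A :=
  tlift (fun p q => (phi q : K) *: p) (T3 b a).

(** Σ b₍₁₎a ⊗ b₍₂₎dφ(b₍₃₎) = E(ya ⊗ d) for y = (ι ⊗ φ)Δ(b). Both sides are unchanged
when a ⊗ d is replaced by E(a ⊗ d), so a ⊗ d may be replaced by a value
Δ(e)(1 ⊗ g), on which the left side is Δ(ye)(1 ⊗ g) = (y ⊗ 1)Δ(e)(1 ⊗ g). *)
Lemma slice_tens b a d :
  tlift (fun p v => p ⊗ slice v d) (T3 b a) = lact E (slice b a ⊗ d).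
Proof.
have [_ _ /(_ b)[y [yt yl yr]]] := phiL.
(* W(a ⊗ d) = Σ b₍₁₎a ⊗ b₍₂₎dφ(b₍₃₎) *)
pose W (w : A ⊗ A) : A ⊗ A := tlift (fun t q => (phi q : K) *: t) (cop3 b w).
have lW : lin_map W by rewrite /W; have := lin_cop3 b; lin.
have ly : lin_map (tmap (lact y) (@id A)) by lin.
have lEy w : lact E (tmap (lact y) id w) = tmap (lact y) id (lact E w).
  move: w; apply: (tens_ext_lin (f := fun w => lact E (tmap _ _ w))
    (g := fun w => tmap _ _ (lact E w))) => [||p q]; [lin|lin|].
  by rewrite -lactE_target// tmapE//; lin.
have WT e g : W (T1 e g) = tmap (lact y) id (T1 e g).
  rewrite /W cop3_T1 tlift_pures; last by lin.
  transitivity (T1 (lact y e) g).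
    rewrite yl (tlift_map (g := fun x => T1 x g)); last by lin.
    by apply: eq_tlift => f q; rewrite (linearZE (f := fun x => T1 x g))//; lin.
  apply: (lact_ll_injm ndA sA) => c.
  rewrite (lact_ll_T1 ndA sA copD) yt -(lact_ll_T1 ndA sA copD).
  rewrite -[LHS]tlift_tpure -[RHS]tlift_tpure !tlift_lact_ll; [|lin..].
  rewrite tlift_tmap; [|lin..].
  by apply: eq_tlift => p q; rewrite ract_lact.
transitivity (W (a ⊗ d)).
  rewrite /W /cop3 tliftE; last by lin.
  rewrite tlift_tlift; last by lin.
  apply: eq_tlift => p v; rewrite tlift_pures; last by lin.
  rewrite /slice (tlift_map (g := fun x => p ⊗ x)); last by lin.
  by apply: eq_tlift => s q; rewrite (linearZE (f := fun x => p ⊗ x))//; lin.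
have <- : lact y a = slice b a by rewrite yl.
have -> : lact y a ⊗ d = tmap (lact y) id (a ⊗ d) by rewrite tmapE//; lin.
rewrite lEy /W -cop3_lactE -/(W _).
have [_ [rT1 _] _ _] := canE.
have [u _ <-] : range (tlift T1) (lact E (a ⊗ d)) by rewrite rT1; exists (a ⊗ d).
rewrite (tlift_map _ _ lW) (tlift_map _ _ ly).
by apply: eq_tlift.
Qed.

(** aS(E₍₁₎)φ(E₍₂₎c) = (ι ⊗ φ)((a ⊗ 1)Δ(c)), with a = S(b). Put L(b ⊗ c) = S(b)y_c,
where y_c = (ι ⊗ φ)Δ(c), and L'(b ⊗ c) = S(b)φ(c); the claim is L' ∘ E = L.
[T2_antipode_lactE] gives L ∘ E = L, so that L' and L have to be compared on
E(A ⊗ A) only, hence on the values Δ(c)(b ⊗ 1) by [lactE_range_T3]. There,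
[slice_tens] and S(E₍₁₎)E₍₂₎ = 1 give
L(Δ(c)(b ⊗ 1)) = Σ S(c₍₁₎b)c₍₂₎φ(c₍₃₎) = S(y_c b) = L'(Δ(c)(b ⊗ 1)). *)
Lemma antipode_integral b c :
  tlift (fun p q => (phi q : K) *: S p) (lact E (b ⊗ c)) =
  tlift (fun p q => (phi q : K) *: p) (T2 (S b) c).
Proof.
pose L' : A ⊗ A -> A := tlift (fun p q => (phi q : K) *: S p).
pose L : A ⊗ A -> A :=
  tlift (fun b c => tlift (fun p q => (phi q : K) *: p) (T2 (S b) c)).
have lL' : lin_map L' by rewrite /L'; lin.
have lL : lin_map L by rewrite /L; lin.
have LT3 c' b' : L (T3 c' b') = L' (T3 c' b').
  transitivity (S (slice c' b')); last first.
    rewrite /slice (tlift_map _ _ lS); apply: eq_tlift => p q.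
    by rewrite (linearZE lS).
  apply: (amul_injr ndA) => d.
  rewrite -(antipode_lactE ndA sA copD regD epsP canE antS SK SinvK) -slice_tens.
  rewrite tlift_pures; last by lin.
  rewrite /L (tlift_map (g := fun x => x ∙ d)); last by lin.
  apply: eq_tlift => p v.
  have [_ _ /(_ v)[y [_ yl yr]]] := phiL.
  by rewrite -yr ract_lact yl.
have [u _ uE] := lactE_range_T3 (b ⊗ c).
have LE : L (lact E (b ⊗ c)) = L (b ⊗ c).
  rewrite {2}/L tliftE; last by lin.
  rewrite -T2_antipode_lactE tlift_tlift; last by lin.
  by [].
rewrite -/(L' _) -[RHS]/((fun b c => tlift _ (T2 (S b) c)) b c).
transitivity (L (b ⊗ c)); last by rewrite /L tliftE//; lin.
rewrite -LE -uE (tlift_map _ _ lL) (tlift_map _ _ lL').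
by apply: eq_tlift.
Qed.

End Integrals.

(** * The action of the dual and the smash product *)

Section Dual.
Variables (K : fieldType) (A : algebra K) (Delta : A -> multiplier (A ⊠ A)).
Hypothesis aqgA : algebraic_quantum_groupoid Delta.
Variables (B : algebra K) (DeltaB : B -> multiplier (B ⊠ B)).
Variables (ev : B -> A -> K^o) (EB : multiplier (B ⊠ B)).
Hypothesis dualB : is_dual Delta DeltaB ev.
Hypothesis canEB : canonical_idempotent DeltaB EB.
Local Notation T2 := (T2 Delta).
Local Notation T4 := (T4 Delta).
Local Notation dact := (dact Delta ev).

Let regWA : regular_weak_multiplier_hopf Delta. Proof. by case: aqgA. Qed.
Let wmhA : weak_multiplier_hopf Delta. Proof. by case: regWA. Qed.
Let regD : regular_coproduct Delta. Proof. by case: regWA. Qed.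
Let wmhC : weak_multiplier_hopf (Delta_cop Delta). Proof. by case: regWA. Qed.
Let ndA : Defs.nondegenerate A. Proof. by case: wmhA. Qed.
Let copD : is_coproduct Delta. Proof. by case: wmhA => _ _ []. Qed.
Let wmhB : weak_multiplier_hopf DeltaB. Proof. by case: (dual_regular dualB). Qed.
Let ndB : Defs.nondegenerate B. Proof. by case: wmhB. Qed.
Let copB : is_coproduct DeltaB. Proof. by case: wmhB => _ _ []. Qed.

Lemma separated_aqg : separated A.
Proof.
have [_ h _] := aqgA.
apply: (@separatesW _ _ [set f | exists phi a, left_integral Delta phi /\
  f = fun x => phi (x ∙ a)]).
split=> [_ [phi [a [[lphi _ _] ->]]]|x x0].
  by apply: (lin_comp (h := phi)) => //; lin.
by apply: h => phi a phiL; apply: (x0 (fun x => phi (x ∙ a))); exists phi, a.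
Qed.
Let sA := separated_aqg.

Lemma separates_integrals :
  separates [set f : A -> K^o | exists phi a, left_integral Delta phi /\
    f = fun x => phi (a ∙ x)].
Proof.
have [_ _ h] := aqgA.
split=> [_ [phi [a [[lphi _ _] ->]]]|x x0].
  by apply: (lin_comp (h := phi)) => //; lin.
by apply: h => phi a phiL; apply: (x0 (fun x => phi (a ∙ x))); exists phi, a.
Qed.

Lemma dual_exists phi a : left_integral Delta phi ->
  exists b, ev b = fun x => phi (a ∙ x).
Proof.
move=> phiL; have : range ev (fun x => phi (a ∙ x)).
  by rewrite (dual_ev_range dualB); apply: lspan_sub; exists phi, a.
by case=> b _ <-; exists b.
Qed.

(** The functionals φ(a ·) only span the dual, so that statements about the dual
are proved on them and extended by [dual_ind]. *)
Definition dual_gen : set B :=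
  [set b | exists phi a, left_integral Delta phi /\ ev b = fun x => phi (a ∙ x)].

Lemma lspan_dual_gen b : lspan dual_gen b.
Proof.
pose Y := [set w : A -> K^o | exists b', lspan dual_gen b' /\ ev b' = w].
suff [b' [hb' /(dual_ev_inj dualB) <-]] : Y (ev b) by [].
have : range ev (ev b) by exists b.
rewrite (dual_ev_range dualB); apply: lspan_min.
  have lev := dual_ev_linear dualB.
  split; first by exists 0; split; [exact: (lspan_subspace _).1|exact: linear0E].
  move=> k _ _ [u [hu <-]] [v [hv <-]]; exists (k *: u + v).
  by split; [exact: (lspan_subspace _).2|exact: lev].
move=> _ [phi [a [phiL ->]]]; have [b' eb'] := dual_exists a phiL.
by exists b'; split=> //; apply: lspan_sub; exists phi, a.
Qed.

Lemma dual_ind (V : lmodType K) (F G : B -> V) :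
  lin_map F -> lin_map G ->
  (forall b phi a, left_integral Delta phi -> ev b = (fun x => phi (a ∙ x)) ->
     F b = G b) -> F =1 G.
Proof.
move=> lF lG FG b.
apply: (@lspan_min _ _ dual_gen [set b | F b = G b] _ _ b (lspan_dual_gen b)).
  split; rewrite /=; first by rewrite (linear0E lF) (linear0E lG).
  by move=> k u v Fu Fv; rewrite lF lG Fu Fv.
by move=> b' [phi [a [phiL eb]]]; apply: FG phiL eb.
Qed.

Lemma bilin_ev : bilin_map ev.
Proof.
have lev x : lin_map (fun b => ev b x).
  by move=> k u v; rewrite (dual_ev_linear dualB).
split=> // b k x y.
have l1 : lin_map (fun b => ev b (k *: x + y)) by [].
have l2 : lin_map (fun b => k *: ev b x + ev b y : K^o).
  by apply: lin_add => //; apply: (lin_scale k).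
apply: (dual_ind l1 l2) => b' phi a [lphi _ _] ->.
by rewrite (lin_bil_r _ (bilin_amul A)) lphi.
Qed.
Let bev := bilin_ev.

Lemma separated_dual : separated B.
Proof.
apply: (@separatesW _ _ [set f | exists x, f = ev^~ x]).
split=> [_ [x ->]|b b0]; first by lin.
apply: (dual_ev_inj dualB); apply/funext => x.
rewrite (linear0E (f := fun b => ev b x)); last by lin.
by apply: (b0 (ev^~ x)); exists x.
Qed.
Let sB := separated_dual.

Lemma separates_ev : separates [set f : A -> K^o | exists b, f = ev b].
Proof.
split=> [_ [b ->]|x x0]; first by lin.
apply: separates_integrals.2 => _ [phi [a [phiL ->]]].
have [b eb] := dual_exists a phiL.
by have := x0 (ev b); rewrite eb; apply; exists b.
Qed.

Let bT1 := bilin_T1 ndA sA copD.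
Let bT2 := bilin_T2 ndA sA copD.
Let bT4 := bilin_T4 ndA sA copD regD.

(** [dact] chooses an element with this property, and it exists: for b = φ(f ·) it
is (ι ⊗ φ)((1 ⊗ f)Δ(a)). *)
Lemma dactE b a c : c ∙ dact b a = tlift (fun p q => (ev b q : K) *: p) (T2 c a).
Proof.
move: c; apply: (@xgetPex _ 0 [set x | forall c,
  c ∙ x = tlift (fun p q => (ev b q : K) *: p) (T2 c a)]).
apply: (@lspan_min _ _ dual_gen [set b | exists x, forall c,
  c ∙ x = tlift (fun p q => (ev b q : K) *: p) (T2 c a)] _ _ b
  (lspan_dual_gen b)).
  split.
    exists 0 => c; rewrite (linear0E (lin_bil_r c (bilin_amul A))).
    by rewrite (linear0E (f := fun b => tlift (fun p q => (ev b q : K) *: p) _))//; lin.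
  move=> k u v [x hx] [y hy]; exists (k *: x + y) => c.
  rewrite (lin_bil_r c (bilin_amul A)) hx hy.
  apply: esym.
  by apply: (_ : lin_map (fun b => tlift (fun p q => (ev b q : K) *: p) _)); lin.
move=> b' [phi [f [phiL eb]]]; exists (tlift (fun p q => (phi q : K) *: p) (T4 f a)).
have lphi : lin_map phi by case: phiL.
move=> c; rewrite (tlift_map (g := fun x => c ∙ x)); last by lin.
under eq_tlift do rewrite (linearZE (lin_bil_r c (bilin_amul A))).
rewrite -(tlift_lact_ll (F := fun p q => (phi q : K) *: p)); last by lin.
rewrite (lact_ll_T4 ndA sA copD regD) tlift_lact_rl; last by lin.
by rewrite eb.
Qed.

Lemma bilin_dact : bilin_map dact.
Proof.
apply: bilinI => x k y z; apply: (amul_injl ndA) => c;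
  rewrite (lin_bil_r c (bilin_amul A)) !dactE.
- by apply: (_ : lin_map (fun b => tlift (fun p q => (ev b q : K) *: p) _)); lin.
- by apply: (_ : lin_map (fun a => tlift (fun p q => (ev x q : K) *: p) (T2 c a))); lin.
Qed.
Let bda := bilin_dact.

Lemma dact_gen b phi f a : left_integral Delta phi ->
  ev b = (fun x => phi (f ∙ x)) ->
  dact b a = tlift (fun p q => (phi q : K) *: p) (T4 f a).
Proof.
move=> phiL eb; have lphi : lin_map phi by case: phiL.
apply: (amul_injl ndA) => c; rewrite dactE.
rewrite (tlift_map (g := fun x => c ∙ x)); last by lin.
under [RHS]eq_tlift do rewrite (linearZE (lin_bil_r c (bilin_amul A))).
rewrite -(tlift_lact_ll (F := fun p q => (phi q : K) *: p)); last by lin.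
rewrite (lact_ll_T4 ndA sA copD regD) tlift_lact_rl; last by lin.
by rewrite eb.
Qed.

(** Δ(b ▷ y) = Σ y₍₁₎ ⊗ (b ▷ y₍₂₎), with the first leg covered. *)
Lemma T2_dact b c y : T2 c (dact b y) = tlift (fun u v => u ⊗ dact b v) (T2 c y).
Proof.
move: b; apply: dual_ind => [||b phi f phiL eb]; [lin|lin|].
have lphi : lin_map phi by case: phiL.
rewrite (dact_gen y phiL eb) (tlift_map (g := T2 c)); last by lin.
pose F (r s q : A) := (phi q : K) *: (r ⊗ s).
transitivity (tlift (fun p q => tlift (fun r s => F r s q) (T2 c p)) (T4 f y)).
  apply: eq_tlift => p q; rewrite (linearZE (lin_bil_r c bT2)) /F.
  rewrite -{1}[T2 c p]tlift_tpure.
  by rewrite (tlift_map (g := fun t => (phi q : K) *: t))//; lin.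
rewrite (coassoc_left ndA sA copD regD (F := F)); last by rewrite /F; lin.
apply: eq_tlift => u v; rewrite (dact_gen v phiL eb).
rewrite (tlift_map (g := fun t => u ⊗ t)); last by lin.
by apply: eq_tlift => s q; rewrite (linearZE (lin_bil_r u (@bilin_tpure _ _ _))).
Qed.

(** <x, ww'> = <w' ▷ x, w>: for w = φ(a ·) and w' = φ'(a' ·) both sides are
(φ ⊗ φ')((a ⊗ a')Δ(x)). *)
Lemma ev_mul w w' x : ev (w ∙ w') x = ev w (dact w' x).
Proof.
move: w; apply: dual_ind => [||w phi a phiL ew]; [lin|lin|].
move: w'; apply: dual_ind => [||w' phi' a' phiL' ew']; [lin|lin|].
have lphi : lin_map phi by case: phiL.
have lphi' : lin_map phi' by case: phiL'.
rewrite (dual_mul dualB x phiL phiL' ew ew') (ract_Delta_pure ndA sA copD).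
rewrite tlift_lact_rl; last by lin.
rewrite ew dactE (tlift_map _ _ lphi); apply: eq_tlift => p q.
by rewrite (linearZE lphi) ew' [RHS]mulrC.
Qed.

Lemma dactM b b' x : dact (b ∙ b') x = dact b (dact b' x).
Proof.
apply: (amul_injl ndA) => c; rewrite !dactE T2_dact tlift_pures; last by lin.
by apply: eq_tlift => p q; rewrite ev_mul.
Qed.

(** The module algebra property, with the second factor covered. Both sides are
Σ x₍₁₎y₍₁₎<x₍₂₎y₍₂₎, b><y₍₃₎, b'>: on the left this is the duality between
the first canonical map of the dual and T2. *)
Lemma T1_dact b b' x y :
  tlift (fun r s => dact r x ∙ dact s y) (Defs.T1 DeltaB b b') =
  dact b (x ∙ dact b' y).
Proof.
apply: (amul_injl ndA) => c.
rewrite (tlift_map (g := fun z => c ∙ z)); last by lin.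
transitivity (tlift (fun r s => tlift (fun p q => tlift (fun u v =>
    (ev r q * ev s v : K) *: u) (T2 p y)) (T2 c x)) (Defs.T1 DeltaB b b')).
  apply: eq_tlift => r s; rewrite amulA (dactE r).
  rewrite (tlift_map (g := fun z => z ∙ dact s y)); last by lin.
  apply: eq_tlift => p q; rewrite (linearZE (f := fun z => z ∙ dact s y)); last by lin.
  rewrite dactE (tlift_map (g := fun z => (ev r q : K) *: z)); last by lin.
  by apply: eq_tlift => u v; rewrite scalerA.
rewrite tlift_exchange dactE (T2_mulr ndA sA copD).
rewrite -[X in ract _ X]tlift_tpure (tlift_map _ _ (@lin_ract _ _ _)).
rewrite tlift_tlift; last by lin.
apply: eq_tlift => p q; rewrite tlift_exchange.
rewrite (ract_Delta_pure ndA sA copD) tlift_lact_rl; last by lin.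
rewrite T2_dact tlift_pures; last by lin.
apply: eq_tlift => u v.
rewrite -(tlift_map (g := fun k : K^o => (k : K) *: u)); last by lin.
congr (_ *: _); rewrite (dual_T1 dualB) dactE.
have lb : lin_map (ev b) by lin.
rewrite (tlift_map _ _ lb); apply: eq_bigr => -[r s] _ /=.
by rewrite (linearZE lb) [LHS]mulrC.
Qed.

(** If all b ▷ x vanish, the slices of (c ⊗ 1)Δ(x) by the elements of the dual
vanish, so (c ⊗ 1)Δ(x) = 0 and cx = 0 by the counit. *)
Lemma dact_eq0 x : (forall b, dact b x = 0) -> x = 0.
Proof.
move=> x0; have [eps epsP] : exists eps, is_counit Delta eps by case: wmhA.
have leps := lin_counit epsP.
apply: ndA.2 => c; have [_ _ <-] := epsP.
suff -> : T2 c x = 0 by apply: (linear0E (lin_tlift _)); lin.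
rewrite -[T2 c x]tflipK (_ : tflip (T2 c x) = 0).
  by rewrite (linear0E (@lin_tflip _ _ _)).
apply: (tens_slice_eq0 separates_ev) => _ [b ->].
rewrite tlift_tflip; last by lin.
by rewrite -dactE x0 (linear0E (lin_bil_r c (bilin_amul A))).
Qed.

(** The span of the b ▷ y contains every slice of (1 ⊗ f)Δ(y) by a functional
φ(g ·); hence it contains the left leg of Δ, which is A because the coopposite
coproduct is full. *)
Lemma dact_span a : lspan [set x | exists b y, x = dact b y] a.
Proof.
set V := lspan _; suff -> : V = setT by [].
have [_ _ [copC [_ fullW]] _ _] := wmhC.
apply: fullW; first exact: lspan_subspace.
move=> f y; rewrite (T2_cop ndA sA regD copC).
apply: (tens_slice_span separates_integrals (lspan_subspace _)).
move=> _ [phi [g [phiL ->]]]; have lphi : lin_map phi by case: phiL.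
rewrite tlift_tflip; last by lin.
rewrite -(tlift_lact_rl (F := fun p q => (phi q : K) *: p)); last by lin.
rewrite -(T4_mull ndA sA regD).
have [b eb] := dual_exists (g ∙ f) phiL.
by rewrite -(dact_gen y phiL eb); apply: lspan_sub; exists b, y.
Qed.

(** The product of A does not see Ê. The map J(p ⊗ q) = (p ▷ x)(q ▷ y) satisfies
J(Δ̂(b)t) = b ▷ J(t) by the module algebra property. As Δ̂(b)Ê = Δ̂(b), every b
kills J(Êt) - J(t), and the action is faithful. *)
Lemma dact_lactEB t x y :
  tlift (fun p q => dact p x ∙ dact q y) (lact EB t) =
  tlift (fun p q => dact p x ∙ dact q y) t.
Proof.
pose J x y t := tlift (fun p q => dact p x ∙ dact q y) t.
have lJ : lin_map (J x y) by rewrite /J; lin.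
have JD b u : J x y (lact (DeltaB b) u) = dact b (J x y u).
  have ld : lin_map (dact b) by lin.
  move: u; apply: (tens_ext_lin (f := fun u => J x y (lact (DeltaB b) u))
    (g := fun u => dact b (J x y u))) => [||p q]; [lin|lin|].
  have [_ idB _ _ _] := wmhB.
  have : lspan [set z : B | exists q1 q2, z = q1 ∙ q2] q by rewrite idB.
  apply: (@lspan_min _ _ _
    [set q | J x y (lact (DeltaB b) (p ⊗ q)) = dact b (J x y (p ⊗ q))]).
    have l1 : lin_map (fun q => J x y (lact (DeltaB b) (p ⊗ q))) by lin.
    have l2 : lin_map (fun q => dact b (J x y (p ⊗ q))) by lin.
    split; rewrite /=; first by rewrite (linear0E l1) (linear0E l2).
    by move=> k u v Fu Fv; rewrite l1 l2 Fu Fv.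
  move=> _ [q1 [q2 ->]] /=.
  rewrite -lact_rl_pure (lact_Delta_rl copB) tmulE_pure_r lact_rl_pure.
  rewrite /J tlift_pures; last by lin.
  rewrite tliftE; last by lin.
  under eq_tlift do rewrite !dactM.
  by rewrite T1_dact dactM.
apply/eqP; rewrite -subr_eq0; apply/eqP; apply: dact_eq0 => b.
rewrite -/(J x y _) -/(J x y _) (linearBE (lin_bil_r b bda)) -!JD.
by rewrite (lact_Delta_E ndB sB copB canEB) subrr.
Qed.

Local Notation smash_act := (smash_act Delta ev).
Local Notation tens_act := (tens_act Delta ev).

Lemma smash_actE z x : smash_act z x = tlift (fun a b => a ∙ dact b x) z.
Proof. by apply: eq_tlift => a b; rewrite dactE. Qed.

Lemma lin_smash_act x : lin_map (fun z => smash_act z x).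
Proof.
move=> k u v; rewrite !smash_actE.
by apply: (_ : lin_map (tlift (fun a b => a ∙ dact b x))); lin.
Qed.

Lemma bilin_tens_act : bilin_map tens_act.
Proof. by rewrite /tens_act; lin. Qed.

Lemma smash_act_lactEB t z x :
  smash_act (tens_act (lact EB t) z) x = smash_act (tens_act t z) x.
Proof.
have E' u : smash_act (tens_act u z) x =
    tlift (fun a b => tlift (fun p q => dact p a ∙ dact q (dact b x)) u) z.
  rewrite smash_actE /tens_act tlift_tlift; last by lin.
  rewrite tlift_exchange.
  under eq_tlift => p q.
    rewrite tlift_pures; last by lin.
    over.
  apply: eq_tlift => p q.
  by apply: eq_tlift => a b; rewrite dactM.
by rewrite !E'; apply: eq_tlift => a b; rewrite dact_lactEB.
Qed.

(** Unitality of the actions of the dual on A and on itself; it makes [mult_act] a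
value with the expected property rather than a default one. *)
Lemma tens_act_span (z : A ⊗ B) : exists s : seq ((B ⊗ B) * (A ⊗ B)),
  z = \sum_(p <- s) tens_act p.1 p.2.
Proof.
pose P := [set z : A ⊗ B | exists s : seq ((B ⊗ B) * (A ⊗ B)),
  z = \sum_(p <- s) tens_act p.1 p.2].
have hP : is_subspace P.
  split; first by exists [::]; rewrite big_nil.
  move=> k _ _ [s ->] [s' ->]; exists ([seq (k *: p.1, p.2) | p <- s] ++ s').
  rewrite big_cat big_map scaler_sumr; congr (_ + _); apply: eq_bigr => p _ /=.
  by rewrite (linearZE (f := fun t => tens_act t p.2))//; exact: bilin_tens_act.1.
suff : P z by [].
rewrite -[z]tlift_tpure; apply: subspace_tlift => // a b.
have := dact_span a; apply: (@lspan_min _ _ _ [set a | P (a ⊗ b)]).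
  have l1 : lin_map (fun a : A => a ⊗ b) by lin.
  split; rewrite /=; first by rewrite (linear0E l1); exact: hP.1.
  by move=> k u v Fu Fv; rewrite l1; exact: hP.2.
move=> _ [p [x ->]] /=.
have [_ idB _ _ _] := wmhB.
have : lspan [set z : B | exists q1 q2, z = q1 ∙ q2] b by rewrite idB.
apply: (@lspan_min _ _ _ [set b | P (dact p x ⊗ b)]).
  have l1 : lin_map (fun b : B => dact p x ⊗ b) by lin.
  split; rewrite /=; first by rewrite (linear0E l1); exact: hP.1.
  by move=> k u v Fu Fv; rewrite l1; exact: hP.2.
move=> _ [q [b' ->]] /=; exists [:: (p ⊗ q, x ⊗ b')]; rewrite big_seq1 /=.
by rewrite /tens_act tliftE ?tliftE//; lin.
Qed.

(** [mult_act] is only known through one decomposition z = Σ tᵢ ▷ zᵢ, and one is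
enough: Êtᵢ ▷ zᵢ and tᵢ ▷ zᵢ act in the same way. *)
Lemma smash_act_mult_act z x :
  smash_act (mult_act Delta ev EB z) x = smash_act z x.
Proof.
have [s zs] := tens_act_span z.
have : exists w, [set w | exists s : seq ((B ⊗ B) * (A ⊗ B)),
    z = \sum_(p <- s) tens_act p.1 p.2 /\
    w = \sum_(p <- s) tens_act (lact EB p.1) p.2] w.
  by exists (\sum_(p <- s) tens_act (lact EB p.1) p.2), s.
move=> /(@xgetPex _ 0) [s' [zs' wE]]; rewrite [mult_act _ _ _ _]wE [in RHS]zs'.
rewrite !(linear_sumE (lin_smash_act x)).
by apply: eq_bigr => p _; rewrite smash_act_lactEB.
Qed.

Lemma smash_act_mul z z' x :
  smash_act (smash_mul Delta DeltaB ev z z') x = smash_act z (smash_act z' x).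
Proof.
have bT1B := bilin_T1 ndB sB copB.
rewrite /smash_mul !smash_actE tlift_tlift; last by lin.
apply: eq_tlift => a b; rewrite tlift_tlift; last by lin.
rewrite (tlift_map (g := fun y => a ∙ dact b y)); last by lin.
apply: eq_tlift => a' b'; rewrite tlift_pures; last by lin.
rewrite -T1_dact (tlift_map (g := fun y => a ∙ y)); last by lin.
by apply: eq_tlift => p q; rewrite amulA.
Qed.

End Dual.

(** * The operators of the smash product *)

Section SmashOperators.
Variables (K : fieldType) (A : algebra K) (Delta : A -> multiplier (A ⊠ A)).
Variables (E : multiplier (A ⊠ A)) (S Sinv : A -> A).
Variables (B : algebra K) (DeltaB : B -> multiplier (B ⊠ B)).
Variables (ev : B -> A -> K^o) (EB : multiplier (B ⊠ B)).
Hypothesis aqgA : algebraic_quantum_groupoid Delta.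
Hypothesis canE : canonical_idempotent Delta E.
Hypothesis antS : is_antipode Delta E (fun a => memb (S a)).
Hypotheses (SK : cancel S Sinv) (SinvK : cancel Sinv S).
Hypothesis dualB : is_dual Delta DeltaB ev.
Hypothesis canEB : canonical_idempotent DeltaB EB.
Local Notation T2 := (T2 Delta).

Let regWA : regular_weak_multiplier_hopf Delta. Proof. by case: aqgA. Qed.
Let wmhA : weak_multiplier_hopf Delta. Proof. by case: regWA. Qed.
Let regD : regular_coproduct Delta. Proof. by case: regWA. Qed.
Let wmhC : weak_multiplier_hopf (Delta_cop Delta). Proof. by case: regWA. Qed.
Let ndA : Defs.nondegenerate A. Proof. by case: wmhA. Qed.
Let idA : idempotent_algebra A. Proof. by case: wmhA. Qed.
Let copD : is_coproduct Delta. Proof. by case: wmhA => _ _ []. Qed.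
Let sA := separated_aqg aqgA.
Let bT2 := bilin_T2 ndA sA copD.
Let nd2 : Defs.nondegenerate (A ⊠ A) := nondegenerate_tens ndA ndA sA sA.

(** x ↦ (ι ⊗ φ)(tΔ(x)). All the operators at hand have this form: for t = a ⊗ c
those of the smash product, for t = (a ⊗ 1)Δ(c) those built from the antipode. *)
Definition slice_operator (phi : A -> K^o) (t : A ⊗ A) (x : A) : A :=
  tlift (fun p q => (phi q : K) *: p) (ract (Delta x) t).

Lemma lin_slice_operator phi : lin_map phi -> lin_map (slice_operator phi).
Proof.
move=> lphi k u v; apply/funext => x; rewrite /slice_operator.
by apply: (_ : lin_map (fun t => tlift _ (ract (Delta x) t))); lin.
Qed.

Lemma slice_operator_ractE phi t :
  slice_operator phi (ract E t) = slice_operator phi t.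
Proof.
apply/funext => x; rewrite /slice_operator -ractE.
by rewrite (E_Delta ndA sA copD canE).
Qed.

(** [antipode_integral] with cx in place of c, since (a ⊗ 1)Δ(cx) is
(a ⊗ 1)Δ(c)Δ(x). *)
Lemma integral_operatorE phi a c : left_integral Delta phi ->
  integral_operator E S Sinv phi a c = slice_operator phi (T2 a c).
Proof.
move=> phiL; have lphi : lin_map phi by case: phiL.
have lS := lin_antipode ndA antS.
have [eps epsP] : exists eps, is_counit Delta eps by case: wmhA.
apply/funext => x; rewrite /integral_operator /SE /slice_operator.
rewrite tlift_tmap; [|lin..].
rewrite -(tlift_ract_rl (F := fun p q => (phi q : K) *: S p)); last by lin.
rewrite -(lact_ractC nd2) ract_rl_pure -(T2_mulr ndA sA copD).
rewrite (antipode_integral ndA sA copD regD epsP canE antS SK SinvK idA wmhC phiL).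
by rewrite SinvK.
Qed.

Lemma slice_operator_pure phi a c b :
  left_integral Delta phi -> ev b = (fun x => phi (c ∙ x)) ->
  slice_operator phi (a ⊗ c) = smash_act Delta ev (a ⊗ b).
Proof.
move=> phiL eb; have lphi : lin_map phi by case: phiL.
have bev := bilin_ev dualB.
apply/funext => x; rewrite /slice_operator (ract_Delta_pure ndA sA copD).
rewrite tlift_lact_rl; last by lin.
by rewrite /smash_act tliftE ?eb//; lin.
Qed.

Lemma lin_smash_operator : lin_map (fun z => smash_act Delta ev z).
Proof.
move=> k u v; apply/funext => x; exact: (lin_smash_act aqgA dualB x k u v).
Qed.

(** The slice operators of t and of tE agree, because EΔ(x) = Δ(x), and (A ⊗ A)E is
spanned by the (a ⊗ 1)Δ(c). So the tensors a ⊗ c and the tensors (a ⊗ 1)Δ(c)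
give the same span of slice operators. *)
Lemma smash_operators :
  range (smash_act Delta ev) =
  lspan [set f | exists a c phi, left_integral Delta phi /\
                   f = integral_operator E S Sinv phi a c].
Proof.
set X := [set f | _].
have lsm := lin_smash_operator.
have bev := bilin_ev dualB.
apply/seteqP; split=> [_ [z _ <-]|].
  rewrite -[z]tlift_tpure (tlift_map (g := fun z => smash_act Delta ev z))//.
  apply: subspace_tlift => [|a b]; first exact: lspan_subspace.
  apply: (@lspan_min _ _ (dual_gen Delta ev)
    [set b | lspan X (smash_act Delta ev (a ⊗ b))] _ _ b
    (lspan_dual_gen dualB b)).
    have l1 : lin_map (fun b : B => smash_act Delta ev (a ⊗ b)).
      by apply: (lin_comp lsm); lin.
    split; rewrite /=; first by rewrite (linear0E l1); exact: (lspan_subspace X).1.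
    by move=> k u v Fu Fv; rewrite l1; exact: (lspan_subspace X).2.
  move=> b' [phi [c [phiL eb]]] /=.
  have lphi : lin_map phi by case: phiL.
  rewrite -(slice_operator_pure a phiL eb) -slice_operator_ractE.
  have [_ [_ rT2] _ _] := canE.
  have [u _ <-] : range (tlift T2) (ract E (a ⊗ c)) by rewrite rT2; exists (a ⊗ c).
  rewrite (tlift_map _ _ (lin_slice_operator lphi)).
  apply: subspace_tlift => [|a' c']; first exact: lspan_subspace.
  apply: lspan_sub; exists a', c', phi; split=> //.
  by rewrite integral_operatorE.
apply: lspan_min; first exact: range_subspace.
move=> _ [a [c [phi [phiL ->]]]]; rewrite integral_operatorE//.
have lphi : lin_map phi by case: phiL.
rewrite -[T2 a c]tlift_tpure (tlift_map _ _ (lin_slice_operator lphi)).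
apply: subspace_tlift => [|p q]; first exact: range_subspace.
have [b eb] := dual_exists dualB q phiL.
by rewrite (slice_operator_pure p phiL eb); exists (p ⊗ b).
Qed.

End SmashOperators.

Theorem proposition5p5 (R : realType)
  (A : algebra R[i]) (Delta : A -> multiplier (A ⊠ A))
  (E : multiplier (A ⊠ A)) (S Sinv : A -> A)
  (B : algebra R[i]) (DeltaB : B -> multiplier (B ⊠ B))
  (ev : B -> A -> R[i]^o) (EB : multiplier (B ⊠ B))
  (hA : algebraic_quantum_groupoid Delta)
  (hE : canonical_idempotent Delta E)
  (hS : is_antipode Delta E (fun a => memb (S a)))
  (SK : cancel S Sinv) (SinvK : cancel Sinv S)
  (hB : is_dual Delta DeltaB ev)
  (hEB : canonical_idempotent DeltaB EB) :
  [/\ forall (a a' : A) (b : B),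
        smash_act Delta ev (mult_act Delta ev EB (a ⊗ b)) a' =
        tlift (fun p q => ev b q *: p) (T2 Delta a a'),
      forall z z' : A ⊗ B,
        smash_sub Delta ev EB z -> smash_sub Delta ev EB z' ->
        smash_act Delta ev (smash_mul Delta DeltaB ev z z') =
        smash_act Delta ev z \o smash_act Delta ev z'
    & smash_act Delta ev @` smash_sub Delta ev EB =
      lspan [set f | exists a c phi, left_integral Delta phi /\
                       f = integral_operator E S Sinv phi a c]].
Proof.
have actE := smash_act_mult_act hA hB hEB.
split=> [a a' b|z z' _ _|].
- rewrite actE (smash_actE hA hB) tliftE; first exact: (dactE hA hB).
  by have bd := bilin_dact hA hB; lin.
- by apply/funext => x; exact: (smash_act_mul hA hB).
rewrite -(smash_operators hA hE hS SK SinvK hB).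
apply/seteqP; split=> [_ [_ [z _ <-] <-]|_ [z _ <-]].
  by exists (mult_act Delta ev EB z).
exists (mult_act Delta ev EB z); first by exists z.
by apply/funext => x; exact: actE.
Qed.
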